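(* Let $G=\{G_n\}_{n\in\mathbb{N}}$ be an ordered mean. Let $\mathbf{A}\in\mathbb{P}^n$, $\omega\in\Delta_n$ and $\lambda\in\Delta_k$. Then for all $\mu_1,\dots,\mu_k>0$ and $p\in[-1,1)$, $$G^{P_p(\lambda;\mu_1,\dots,\mu_k)}(\omega;\mathbf{A})\ge P_p\left(\lambda;G^{\frac{\mu_1}{K}}(\omega;\mathbf{A}),\dots,G^{\frac{\mu_k}{K}}(\omega;\mathbf{A})\right),$$ where $K=\frac{(\mu_{\max}+\mu_{\min})^2}{4\mu_{\max}\mu_{\min}}$ for $\mu_{\max}=\max\{\mu_1,\dots,\mu_k\}$ and $\mu_{\min}=\min\{\mu_1,\dots,\mu_k\}$.
   Context: Let $\mathcal{H}$ be a Hilbert space and $\mathbb{P}$ the open convex cone of positive invertible bounded linear operators on $\mathcal{H}$; $I$ is the identity. For self-adjoint $A,B$, $A\le B$ means $B-A$ is positive semi-definite (Loewner order). $\Delta_n$ is the set of probability vectors $\omega=(w_1,\dots,w_n)\in\mathbb{R}^n$ with all $w_i>0$ and $\sum_i w_i=1$. An ordered mean is a family $G=\{G_n\}_{n\in\mathbb{N}}$ of maps $G_n:\Delta_n\times\mathbb{P}^n\to\mathbb{P}$ such that for every $n$, all $\mathbf{A},\mathbf{B}\in\mathbb{P}^n$, $\omega\in\Delta_n$ and real $a>0$: (P1) $G_n(\omega;a\mathbf{A})=aG_n(\omega;\mathbf{A})$; (P2) $G_n(\omega;\mathbf{B})\le G_n(\omega;\mathbf{A})$ whenever $B_i\le A_i$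 for all $i$; (P3) $G_n(\omega;(1-s)\mathbf{A}+s\mathbf{B})\ge(1-s)G_n(\omega;\mathbf{A})+sG_n(\omega;\mathbf{B})$ for $0\le s\le1$; (P4) $\left[\sum_{i=1}^n w_iA_i^{-1}\right]^{-1}\le G_n(\omega;\mathbf{A})\le\sum_{i=1}^n w_iA_i$. Parameterized ordered mean: for real $\mu\ge0$ and $\mathbf{A}\in\mathbb{P}^n$, $G^\mu(\omega;\mathbf{A})=G_n^\mu(\omega;\mathbf{A}):=G_n(\omega;A_1+\mu I,\dots,A_n+\mu I)-\mu I$ (an element of $\mathbb{P}$). Power means: $A\#_pB=A^{1/2}(A^{-1/2}BA^{-1/2})^pA^{1/2}$. For $\lambda\in\Delta_k$ and $X_1,\dots,X_k\in\mathbb{P}$: for $p\in(0,1]$, $P_p(\lambda;X_1,\dots,X_k)$ is the unique solution $X\in\mathbb{P}$ of $X=\sum_{i=1}^k\lambda_i\,X\#_pX_i$; for $p\in[-1,0)$, $P_p(\lambda;X_1,\dots,X_k)=P_{-p}(\lambda;X_1^{-1},\dots,X_k^{-1})^{-1}$; and $P_0(\lambda;X_1,\dots,X_k)=\Lambda(\lambda;X_1,\dots,X_k)$ is the Karcher mean, the unique solution $X\in\mathbb{P}$ of $\sum_{i=1}^k\lambda_i\log(X^{1/2}X_i^{-1}X^{1/2})=0$. For positive scalars $P_p(\lambda;a_1,\dots,a_k)=(\sum_i\lambda_ia_i^p)^{1/p}$ if $p\ne0$ and $\prod_ia_i^{\lambda_i}$ if $p=0$. *)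

(* Defs.v *)
From HB Require Import structures.
From mathcomp Require Import all_boot all_order all_algebra.
From mathcomp Require Import sesquilinear.
From mathcomp Require Import all_classical all_reals all_analysis.
From mathcomp Require Import complex.

Set Implicit Arguments.
Unset Strict Implicit.
Unset Printing Implicit Defensive.

Import Order.TTheory GRing.Theory Num.Theory.
Import numFieldNormedType.Exports.

Local Open Scope ring_scope.
Local Open Scope classical_set_scope.
Local Open Scope complex_scope.

(* Operators on H are plain functions H -> H, which form a module over R[i]
   under the pointwise operations; composition is the product and id is I. *)

Section Operators.
Variables (R : realType) (H : completeNormedModType R[i]).
Variable dot : {dot H for (Num.conj : R[i] -> R[i])}.

(* Makes H the Hilbert space of the inner product dot: dot is linear in its
   first argument, and H is complete for the norm. *)
Definition norm_from_dot : Prop := forall x : H, `|x| ^+ 2 = dot x x.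

Definition op_norm_le (A : H -> H) (c : R) : Prop :=
  forall x : H, `|A x| <= c%:C * `|x|.

Definition bounded_op (A : H -> H) : Prop :=
  linear A /\ exists c : R, op_norm_le A c.

(* 0 <= z in R[i] says that z is real and nonnegative. As H is complex, a
   bounded operator with this property is self-adjoint. *)
Definition psd (A : H -> H) : Prop := forall x : H, 0 <= dot (A x) x.

Definition loewner_le (A B : H -> H) : Prop := psd (B - A).

Definition is_inverse (A B : H -> H) : Prop :=
  [/\ bounded_op B, A \o B = id & B \o A = id].

Definition opinv (A : H -> H) : H -> H := xget 0 [set B | is_inverse A B].

Definition pos_cone (A : H -> H) : Prop :=
  [/\ bounded_op A, psd A & exists B, is_inverse A B].

Definition poly_op (q : {poly R}) (A : H -> H) : H -> H :=
  \sum_(i < size q) (q`_i)%:C *: iter i A.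

(* B = f(A) in the continuous functional calculus of the self-adjoint operator
   A: B is a norm limit of polynomials q(A), where q tends to f uniformly on an
   interval [m, M] with m I <= A <= M I. The operator B does not depend on the
   interval; for A in the cone and f a power or ln, one takes m > 0. *)
Definition is_fun_calc (f : R -> R) (A B : H -> H) : Prop :=
  exists m M : R,
    [/\ loewner_le (m%:C *: id) A, loewner_le A (M%:C *: id) &
      forall e : R, 0 < e -> exists q : {poly R},
        (forall t, m <= t <= M -> `|f t - q.[t]| <= e) /\
        op_norm_le (B - poly_op q A) e].

Definition fun_calc (f : R -> R) (A : H -> H) : H -> H :=
  xget 0 [set B | is_fun_calc f A B].

Definition oppow (A : H -> H) (p : R) : H -> H := fun_calc (fun t => t `^ p) A.

Definition oplog (A : H -> H) : H -> H := fun_calc (@ln R) A.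

Definition geo_mean (p : R) (A B : H -> H) : H -> H :=
  let rA := oppow A 2^-1 in
  let irA := oppow A (- 2^-1) in
  rA \o oppow (irA \o B \o irA) p \o rA.

Definition prob_vec (n : nat) (w : 'I_n -> R) : Prop :=
  (forall i, 0 < w i) /\ \sum_i w i = 1.

(* The values of G outside of Delta_n x P^n are irrelevant. *)
Record ordered_mean
    (G : forall n : nat, ('I_n -> R) -> ('I_n -> H -> H) -> H -> H) : Prop := {
  om_cone : forall n w (A : 'I_n -> H -> H),
    prob_vec w -> (forall i, pos_cone (A i)) -> pos_cone (G n w A);
  om_homogeneous : forall n w (A : 'I_n -> H -> H) (a : R),
    prob_vec w -> (forall i, pos_cone (A i)) -> 0 < a ->
    G n w (fun i => a%:C *: A i) = a%:C *: G n w A;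
  om_monotone : forall n w (A B : 'I_n -> H -> H),
    prob_vec w -> (forall i, pos_cone (A i)) -> (forall i, pos_cone (B i)) ->
    (forall i, loewner_le (B i) (A i)) ->
    loewner_le (G n w B) (G n w A);
  om_concave : forall n w (A B : 'I_n -> H -> H) (s : R),
    prob_vec w -> (forall i, pos_cone (A i)) -> (forall i, pos_cone (B i)) ->
    0 <= s <= 1 ->
    loewner_le ((1 - s)%:C *: G n w A + s%:C *: G n w B)
               (G n w (fun i => (1 - s)%:C *: A i + s%:C *: B i));
  om_arith_harm : forall n w (A : 'I_n -> H -> H),
    prob_vec w -> (forall i, pos_cone (A i)) ->
    loewner_le (opinv (\sum_i (w i)%:C *: opinv (A i))) (G n w A) /\
    loewner_le (G n w A) (\sum_i (w i)%:C *: A i)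
}.

Definition param_mean
    (G : forall n : nat, ('I_n -> R) -> ('I_n -> H -> H) -> H -> H)
    (mu : R) (n : nat) (w : 'I_n -> R) (A : 'I_n -> H -> H) : H -> H :=
  G n w (fun i => A i + mu%:C *: id) - mu%:C *: id.

Definition is_pos_power_mean (p : R) (k : nat) (lam : 'I_k -> R)
    (X : 'I_k -> H -> H) (Y : H -> H) : Prop :=
  pos_cone Y /\ Y = \sum_j (lam j)%:C *: geo_mean p Y (X j).

Definition is_karcher_mean (k : nat) (lam : 'I_k -> R)
    (X : 'I_k -> H -> H) (Y : H -> H) : Prop :=
  let rY := oppow Y 2^-1 in
  pos_cone Y /\ \sum_j (lam j)%:C *: oplog (rY \o opinv (X j) \o rY) = 0.

(* Y = P_p(lam; X_1, ..., X_k), for -1 <= p <= 1 and X_1, ..., X_k in the cone,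
   where the defining equations have exactly one solution. *)
Definition is_power_mean (p : R) (k : nat) (lam : 'I_k -> R)
    (X : 'I_k -> H -> H) (Y : H -> H) : Prop :=
  if 0 < p then is_pos_power_mean p lam X Y
  else if p < 0 then
    exists Z, is_pos_power_mean (- p) lam (fun j => opinv (X j)) Z /\
              Y = opinv Z
  else is_karcher_mean lam X Y.

End Operators.

Section Scalars.
Variable R : realType.

Definition scalar_power_mean (p : R) (k : nat) (lam a : 'I_k -> R) : R :=
  if p == 0 then \prod_j (a j `^ lam j)
  else (\sum_j lam j * a j `^ p) `^ p^-1.

(* For k > 0 and positive mu the starting values 0 and vmax mu of the iterated
   max and min have no effect. *)
Definition vmax (k : nat) (mu : 'I_k -> R) : R := \big[Num.max/0]_j mu j.
Definition vmin (k : nat) (mu : 'I_k -> R) : R := \big[Num.min/vmax mu]_j mu j.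

Definition kantorovich (k : nat) (mu : 'I_k -> R) : R :=
  (vmax mu + vmin mu) ^+ 2 / (4 * vmax mu * vmin mu).

End Scalars.

(* Main.v *)
(* Write f(nu) for the operator G^nu(w; A). Homogeneity and concavity make G
   superadditive, and G fixes the scalar operators; hence f is increasing and
   concave on ]0, +oo[. Both power means are compared with the arithmetic mean:
     P_p(f(mu_j / K)) <= sum_j lam_j f(mu_j / K) <= f(sum_j lam_j mu_j / K),
   and the Kantorovich inequality bounds sum_j lam_j mu_j / K by the harmonic
   mean of the mu_j, which is at most P_p(mu) as p >= -1.
   The inequality P_p <= P_1 for operators comes, through the functional
   calculus, from t^p <= 1 - p + p t when p > 0, t^-1 >= 1 + (1 - t^q) / q when
   p = - q < 0, and t^-1 >= 1 - ln t when p = 0, applied to the operators inside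
   the defining equation of the mean.
   The functional calculus rests on the positivity of q(A) for a polynomial q
   nonnegative on an interval [m, M] with m <= A <= M. If s > 0 is the least
   number with q(A) + s >= 0, then the linear factors A - z of q(A) + s over the
   complex numbers have no z in [m, M], so that they are all bounded below;
   hence so are q(A) + s and its quadratic form, and s was not the least. *)
Require Import Defs.
From HB Require Import structures.
From mathcomp Require Import all_boot all_order all_algebra.
From mathcomp Require Import sesquilinear.
From mathcomp Require Import all_classical all_reals all_analysis.
From mathcomp Require Import complex ring lra.

Set Implicit Arguments.
Unset Strict Implicit.
Unset Printing Implicit Defensive.

Import Order.TTheory GRing.Theory Num.Theory.
Import numFieldNormedType.Exports.

Local Open Scope ring_scope.
Local Open Scope classical_set_scope.
Local Open Scope complex_scope.

(** * Uniform approximation by polynomials *)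

Section UniformApproximation.
Variable R : realType.
Implicit Types (f g : R -> R) (q : {poly R}) (m M : R).

(** Each function in use below is approximated by explicit polynomials, so no general density
    theorem is invoked. *)
Definition poly_approx m M f : Prop := forall e : R, 0 < e ->
  exists q, forall t, m <= t <= M -> `|f t - q.[t]| <= e.

Lemma horner_bounded q m M :
  exists2 b : R, 0 < b & forall t, m <= t <= M -> `|q.[t]| <= b.
Proof.
(* [T] bounds the modulus of every [t] in the interval; the summand 1 makes the bound strictly
   positive, so that later proofs can divide by it. *)
pose T : R := `|m| + `|M|.
exists (1 + \sum_(i < size q) `|q`_i| * T ^+ i).
  by rewrite ltr_pwDl// sumr_ge0// => i _; rewrite mulr_ge0// exprn_ge0// addr_ge0.
move=> t mt; rewrite horner_coef (le_trans (ler_norm_sum _ _ _))// ler_wpDl//.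
apply: ler_sum => i _; rewrite normrM ler_wpM2l// normrX lerXn2r ?nnegrE//.
  by rewrite addr_ge0.
rewrite /T; case/andP: mt => mt tM.
have := ler_norm M; have := lerNnormlW (lexx `|m|).
by rewrite ler_norml => h1 h2; apply/andP; split; have := normr_ge0 M;
   have := normr_ge0 m; lra.
Qed.

Lemma poly_approx_poly m M q : poly_approx m M (horner q).
Proof. by move=> e e0; exists q => t _; rewrite subrr normr0 ltW. Qed.

Lemma poly_approx_lim m M f :
  (forall e, 0 < e -> exists2 g, poly_approx m M g &
     forall t, m <= t <= M -> `|f t - g t| <= e) ->
  poly_approx m M f.
Proof.
move=> fg e e0; have e2 : 0 < e / 2 by rewrite divr_gt0.
have [g /(_ _ e2)[q gq] fgt] := fg _ e2; exists q => t mt.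
rewrite (splitr e) (le_trans (ler_distD (g t) _ _))// lerD//.
  exact: fgt.
exact: gq.
Qed.

Lemma poly_approxD m M f g : poly_approx m M f -> poly_approx m M g ->
  poly_approx m M (fun t => f t + g t).
Proof.
move=> hf hg e e0; have e2 : 0 < e / 2 by rewrite divr_gt0.
have [q fq] := hf _ e2; have [r gr] := hg _ e2; exists (q + r) => t mt.
rewrite hornerD opprD addrACA (splitr e) (le_trans (ler_normD _ _))// lerD//.
  exact: fq.
exact: gr.
Qed.

Lemma poly_approx_bounded m M f : poly_approx m M f ->
  exists2 b : R, 0 < b & forall t, m <= t <= M -> `|f t| <= b.
Proof.
move=> /(_ 1 ltr01)[q fq]; have [b b0 qb] := horner_bounded q m M.
exists (b + 1); first by rewrite addr_gt0.
move=> t mt; rewrite -(subrK q.[t] (f t)) (le_trans (ler_normD _ _))// addrC.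
by rewrite lerD ?qb ?fq.
Qed.

Lemma poly_approxM m M f g : poly_approx m M f -> poly_approx m M g ->
  poly_approx m M (fun t => f t * g t).
Proof.
move=> hf hg e e0; have [b b0 fb] := poly_approx_bounded hf.
(* [r] comes before [q]: in [f g - q r = f (g - r) + (f - q) r], the precision asked of [q] depends
   on the bound [c] of [r]. *)
have [r gr] := hg (e / (2 * b)) (divr_gt0 e0 (mulr_gt0 (ltr0Sn R 1) b0)).
have [c c0 rc] := horner_bounded r m M.
have [q fq] := hf (e / (2 * c)) (divr_gt0 e0 (mulr_gt0 (ltr0Sn R 1) c0)).
exists (q * r) => t mt; rewrite hornerM.
have -> : f t * g t - q.[t] * r.[t] =
          f t * (g t - r.[t]) + (f t - q.[t]) * r.[t] by ring.
rewrite (le_trans (ler_normD _ _))// !normrM.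
have -> : e = b * (e / (2 * b)) + (e / (2 * c)) * c.
  by field; rewrite !gt_eqF.
by rewrite lerD// ler_pM// ?gr ?fb ?rc ?fq.
Qed.

(** Horner's scheme reduces the composition to sums and products. *)
Lemma poly_approx_comp m M q g : poly_approx m M g ->
  poly_approx m M (fun t => q.[g t]).
Proof.
move=> hg; elim/poly_ind: q => [|q c IH].
  have -> : (fun t => 0.[g t]) = horner (0 : {poly R}).
    by apply/funext => t; rewrite !horner0.
  exact: poly_approx_poly.
have -> : (fun t => (q * 'X + c%:P).[g t]) =
          (fun t => q.[g t] * g t + c%:P.[t]).
  by apply/funext => t; rewrite !hornerE.
exact: (poly_approxD (poly_approxM IH hg) (@poly_approx_poly _ _ _)).
Qed.

(** With [u = 1 - t / M], [t^-1] is [M^-1] times the geometric series of ratio [u]. The partial sums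
    leave the error [u ^+ n / t], at most [r ^+ n / m], as [r = 1 - m / M] bounds [u]. *)
Lemma poly_approx_inv m M : 0 < m -> poly_approx m M (fun t => t^-1).
Proof.
move=> m0 e e0; have [mM|Mm] := leP m M; last first.
  by exists 0 => t /andP[mt tM]; lra.
have M0 : 0 < M by exact: lt_le_trans mM.
pose r : R := 1 - m / M.
have r01 : 0 <= r < 1.
  by rewrite subr_ge0 ler_pdivrMr// mul1r mM ltrBlDr ltrDl divr_gt0.
have : `|r| < 1 by case/andP: r01 => r0 r1; rewrite ger0_norm.
move=> /cvg_expr /cvgrPdist_le/(_ (e * m)).
rewrite mulr_gt0// => /(_ isT)[n _ /(_ n (leqnn n))] /=.
rewrite sub0r normrN => rn.
exists (M^-1 *: \sum_(k < n) (1 - M^-1 *: 'X) ^+ k) => t /andP[mt tM].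
have t0 : 0 < t by exact: lt_le_trans mt.
pose u := 1 - t / M.
have -> : (M^-1 *: \sum_(k < n) (1 - M^-1 *: 'X) ^+ k).[t] = (1 - u ^+ n) / t.
  rewrite hornerZ horner_sum.
  under eq_bigr do rewrite horner_exp !hornerE (mulrC M^-1) -/u.
  rewrite -[X in (X - _) / _](expr1n R n) subrXX.
  under [in RHS]eq_bigr do rewrite expr1n mul1r.
  have -> : 1 - u = t / M by rewrite /u; ring.
  by field; rewrite !gt_eqF.
have u0 : 0 <= u by rewrite subr_ge0 ler_pdivrMr// mul1r.
have -> : t^-1 - (1 - u ^+ n) / t = u ^+ n / t by ring.
rewrite ger0_norm; last by rewrite divr_ge0 ?exprn_ge0// ltW.
rewrite ler_pdivrMr//; apply: (@le_trans _ _ (r ^+ n)).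
  rewrite lerXn2r ?nnegrE//; first by case/andP: r01.
  by rewrite lerB// ler_pM2r ?invr_gt0.
rewrite (le_trans (ler_norm _))// (le_trans rn)// ler_pM2l//.
Qed.

Lemma poly_antiderivative q : exists Q : {poly R}, deriv Q = q.
Proof.
(* The coefficient at index 0 is a division by 0, hence 0; differentiation discards it. *)
exists (\poly_(i < (size q).+1) (q`_i.-1 / i%:R)).
apply/polyP => i; rewrite coef_deriv coef_poly ltnS.
case: ltnP => [_|qi]; last by rewrite mul0rn nth_default.
by rewrite /= -[X in X = _]mulr_natr divfK// pnatr_eq0.
Qed.

(** Integrates the preceding approximation: if [Q] is an antiderivative of a polynomial within [d]
    of [t^-1], the derivative of [ln - Q] is at most [d] in modulus, and the mean value theorem
    bounds its variation by [d * (M - m) = e]. *)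
Lemma poly_approx_ln m M : 0 < m -> poly_approx m M (@ln R).
Proof.
move=> m0 e e0; have [mM|Mm] := leP M m.
  exists (ln m)%:P => t /andP[mt tM]; rewrite hornerC.
  by have -> : t = m by [apply/eqP; rewrite eq_le; lra]; rewrite subrr normr0 ltW.
pose d := e / (M - m); have Mm0 : 0 < M - m by rewrite subr_gt0.
have d0 : 0 < d by rewrite divr_gt0.
have [q tq] := @poly_approx_inv m M m0 _ d0.
have [Q Qq] := poly_antiderivative q.
pose h (t : R) := ln t - Q.[t].
exists (Q + (h m)%:P) => t /andP[mt tM].
have -> : ln t - (Q + (h m)%:P).[t] = h t - h m.
  by rewrite hornerD hornerC /h; ring.
have hd (x : R) : m <= x -> is_derive x 1 h (x^-1 - q.[x]).
  move=> mx; have x0 : 0 < x by exact: lt_le_trans mx.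
  by rewrite -Qq; apply: is_deriveB; exact: is_derive1_ln.
have hc : {within `[m, t], continuous h}.
  apply: derivable_within_continuous => x; rewrite in_itv/= => /andP[mx _].
  exact: (@ex_derive _ _ _ _ _ _ _ (hd x mx)).
have hd' (x : R) : x \in `]m, t[%R -> is_derive x 1 h (x^-1 - q.[x]).
  by rewrite in_itv/= => /andP[mx _]; apply: hd; exact: ltW.
have [c] := MVT_segment mt hd' hc.
rewrite in_itv/= => /andP[mc ct] ->; rewrite normrM.
have -> : e = d * (M - m) by rewrite divfK// gt_eqF.
apply: ler_pM => //; first by apply: tq; rewrite mc (le_trans ct).
by rewrite ger0_norm ?subr_ge0// lerB.
Qed.

(** The tail of the exponential series at [t] is dominated termwise by the tail at [Y >= |t|], so
    the order [n] chosen for [Y] serves the whole interval. *)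
Lemma poly_approx_expR m M : poly_approx m M (@expR R).
Proof.
move=> e e0; pose Y : R := `|m| + `|M|.
have S_poly n (y : R) : series (exp_coeff y) n = (\sum_(k < n) (k`!%:R)^-1 *: 'X^k).[y].
  rewrite horner_sum /series/= big_mkord; apply: eq_bigr => k _.
  by rewrite !hornerE exp_coeffE.
have cS (y : R) : series (exp_coeff y) @ \oo --> expR y.
  exact: is_cvg_series_exp_coeff.
have := cS Y => /cvgrPdist_le/(_ e e0)[n _ /(_ n (leqnn n))] /= Yn.
exists (\sum_(k < n) (k`!%:R)^-1 *: 'X^k) => t /andP[mt tM].
have tY : `|t| <= Y.
  rewrite /Y; have := ler_norm M; have := lerNnormlW (lexx `|m|).
  by rewrite ler_norml => h1 h2; apply/andP; split; have := normr_ge0 M;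
     have := normr_ge0 m; lra.
rewrite -S_poly.
have cB (y : R) : (fun k => series (exp_coeff y) k - series (exp_coeff y) n) @ \oo -->
            expR y - series (exp_coeff y) n.
  by apply: cvgB; [exact: cS|exact: cvg_cst].
apply: le_trans Yn; rewrite (le_trans _ (ler_norm _))//.
apply: (ler_cvg_to (cvg_norm (cB t)) (cB Y)).
exists n => // k /= nk; rewrite !sub_series_geq//.
rewrite (le_trans (ler_norm_sum _ _ _))//; apply: ler_sum => i _.
by rewrite !exp_coeffE normrM ger0_norm ?invr_ge0// ler_wpM2l ?invr_ge0//
  normrX lerXn2r// nnegrE addr_ge0.
Qed.

(** Since [t ^ p] is the exponential of [p * ln t], it suffices to approximate the exponential on
    the bounded range of [p * ln t]. *)
Lemma poly_approx_powR m M p : 0 < m -> poly_approx m M (fun t => t `^ p).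
Proof.
move=> m0; apply: poly_approx_lim => e e0.
have lnp : poly_approx m M (fun t => p * ln t).
  apply: poly_approxM; last exact: poly_approx_ln.
  have -> : (fun=> p) = horner p%:P by apply/funext => t; rewrite hornerC.
  exact: poly_approx_poly.
have [b b0 lnb] := poly_approx_bounded lnp.
have [q expq] := @poly_approx_expR (- b) b _ e0.
exists (fun t => q.[p * ln t]); first exact: poly_approx_comp.
move=> t /andP[mt tM]; rewrite /powR gt_eqF; last exact: lt_le_trans mt.
by apply: expq; rewrite -ler_norml lnb// mt.
Qed.

End UniformApproximation.

(** * Self-adjoint operators and polynomials in an operator *)

Section Hilbert.
Variables (R : realType) (H : completeNormedModType R[i]).
Variable dot : {dot H for (Num.conj : R[i] -> R[i])}.
Hypothesis hdot : norm_from_dot dot.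
Implicit Types (A B T : H -> H) (x y : H).

(** Orders and norms are read off this real symmetric form, where [lra] and [nra] apply; [rdot_ir]
    recovers the imaginary part of [dot]. *)
Definition rdot x y : R := complex.Re (dot x y).
Definition sqn x : R := rdot x x.

Lemma ReD (a b : R[i]) : complex.Re (a + b) = complex.Re a + complex.Re b.
Proof. by case: a b => ? ? []. Qed.

Lemma ReN (a : R[i]) : complex.Re (- a) = - complex.Re a.
Proof. by case: a. Qed.

Lemma ReZ (a : R) (b : R[i]) : complex.Re (a%:C * b) = a * complex.Re b.
Proof. by case: b => ? ? /=; rewrite mul0r subr0. Qed.

Lemma Re_conj (a : R[i]) : complex.Re (Num.conj a) = complex.Re a.
Proof. by case: a. Qed.

Lemma Im_conj (a : R[i]) : complex.Im (Num.conj a) = - complex.Im a.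
Proof. by case: a. Qed.

Lemma Re_imul (a : R[i]) : complex.Re ('i * a) = - complex.Im a.
Proof. by case: a => ? ? /=; rewrite mul0r mul1r sub0r. Qed.

Lemma dotC x y : dot x y = Num.conj (dot y x).
Proof. by rewrite [LHS]hermC expr0 mul1r. Qed.

Lemma rdotC x y : rdot x y = rdot y x.
Proof. by rewrite /rdot dotC Re_conj. Qed.

Lemma rdotDl x y z : rdot (x + y) z = rdot x z + rdot y z.
Proof. by rewrite /rdot linearDl; exact: ReD. Qed.

Lemma rdotZl (a : R) x y : rdot (a%:C *: x) y = a * rdot x y.
Proof. by rewrite /rdot linearZl_LR; exact: ReZ. Qed.

Lemma rdotNl x y : rdot (- x) y = - rdot x y.
Proof. by rewrite /rdot linearNl; exact: ReN. Qed.

Lemma rdotDr x y z : rdot x (y + z) = rdot x y + rdot x z.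
Proof. by rewrite rdotC rdotDl !(rdotC x). Qed.

Lemma rdotZr (a : R) x y : rdot x (a%:C *: y) = a * rdot x y.
Proof. by rewrite rdotC rdotZl rdotC. Qed.

Lemma rdotNr x y : rdot x (- y) = - rdot x y.
Proof. by rewrite rdotC rdotNl rdotC. Qed.

Definition rdotE := (rdotDl, rdotDr, rdotNl, rdotNr, rdotZl, rdotZr).

Lemma rdot0l x : rdot 0 x = 0.
Proof. by rewrite -(scale0r 0) -[0 in X in rdot (X *: _)]/(0%:C) rdotZl mul0r. Qed.

Lemma rdot_suml (I : Type) (r : seq I) (P : pred I) (F : I -> H) x :
  rdot (\sum_(i <- r | P i) F i) x = \sum_(i <- r | P i) rdot (F i) x.
Proof.
by apply: (big_morph (rdot^~ x)) => [y z|]; rewrite ?rdotDl ?rdot0l.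
Qed.

Lemma rdot_il x y : rdot ('i *: x) y = - complex.Im (dot x y).
Proof. by rewrite /rdot linearZl_LR; exact: Re_imul. Qed.

Lemma Im_dotC x y : complex.Im (dot x y) = - complex.Im (dot y x).
Proof. by rewrite dotC Im_conj. Qed.

Lemma rdot_ir x y : rdot x ('i *: y) = complex.Im (dot x y).
Proof. by rewrite rdotC rdot_il Im_dotC opprK. Qed.

Lemma normE x : `|x| ^+ 2 = (sqn x)%:C.
Proof.
rewrite hdot [LHS](complexE) /sqn /rdot.
suff -> : complex.Im (dot x x) = 0 by rewrite mulr0 addr0.
by have /eqP := Im_dotC x x; rewrite -addr_eq0 -mulr2n mulrn_eq0 => /eqP.
Qed.

Lemma sqn_ge0 x : 0 <= sqn x.
Proof. by rewrite -ler0c -normE exprn_ge0. Qed.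

Lemma sqnN x : sqn (- x) = sqn x.
Proof. by rewrite /sqn rdotNl rdotNr opprK. Qed.

Lemma sqn_eq0 x : sqn x = 0 -> x = 0.
Proof.
move=> x0; have := normE x; rewrite x0 => /eqP.
by rewrite sqrf_eq0 normr_eq0 => /eqP.
Qed.

Lemma op_norm_le_sqn A (c : R) : op_norm_le A c ->
  forall x, sqn (A x) <= c ^+ 2 * sqn x.
Proof.
move=> Ac x; have := Ac x.
rewrite -(@ler_pXn2r _ 2) ?nnegrE//; last exact: le_trans (Ac x).
by rewrite exprMn !normE -rmorphXn -rmorphM lecR.
Qed.

Lemma sqn_op_norm_le A (c : R) : 0 <= c ->
  (forall x, sqn (A x) <= c ^+ 2 * sqn x) -> op_norm_le A c.
Proof.
move=> c0 Ac x.
rewrite -(@ler_pXn2r _ 2) ?nnegrE ?mulr_ge0 ?ler0c//.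
by rewrite exprMn !normE -rmorphXn -rmorphM lecR.
Qed.

Lemma bounded_opP A : bounded_op A ->
  exists2 c : R, 0 < c & op_norm_le A c.
Proof.
move=> [_ [c Ac]]; exists (`|c| + 1); first by rewrite ltr_pwDr.
move=> x; rewrite (le_trans (Ac x))// ler_wpM2r// lecR.
by rewrite (le_trans (ler_norm c))// lerDl.
Qed.

Section Linear.
Variable A : H -> H.
Hypothesis linA : linear A.

Lemma linD x y : A (x + y) = A x + A y.
Proof. by have := linA 1 x y; rewrite !scale1r. Qed.

Lemma lin0 : A 0 = 0.
Proof. by apply: (addIr (A 0)); rewrite -linD !add0r. Qed.

Lemma linZ a x : A (a *: x) = a *: A x.
Proof. by have := linA a x 0; rewrite lin0 !addr0. Qed.

Lemma linN x : A (- x) = - A x.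
Proof. by rewrite -scaleN1r linZ scaleN1r. Qed.

Lemma lin_sum (I : Type) (r : seq I) (P : pred I) (F : I -> H) :
  A (\sum_(i <- r | P i) F i) = \sum_(i <- r | P i) A (F i).
Proof. exact: (big_morph A linD lin0). Qed.

End Linear.

Lemma bounded_id : bounded_op (@id H).
Proof. by split=> //; exists 1 => x; rewrite mul1r. Qed.

Lemma op_norm_leD A B (a b : R) : op_norm_le A a -> op_norm_le B b ->
  op_norm_le (A + B) (a + b).
Proof.
by move=> Aa Bb x; rewrite (le_trans (ler_normD _ _))// rmorphD mulrDl lerD.
Qed.

Lemma op_norm_leB A B (a b : R) : op_norm_le A a -> op_norm_le B b ->
  op_norm_le (A - B) (a + b).
Proof.
by move=> Aa Bb x; rewrite (le_trans (ler_normB _ _))// rmorphD mulrDl lerD.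
Qed.

Lemma op_norm_leM A B (a b : R) : 0 <= a -> op_norm_le A a -> op_norm_le B b ->
  op_norm_le (A \o B) (a * b).
Proof.
move=> a0 Aa Bb x; rewrite (le_trans (Aa _))// rmorphM -mulrA ler_wpM2l//.
by rewrite ler0c.
Qed.

Lemma boundedD A B : bounded_op A -> bounded_op B -> bounded_op (A + B).
Proof.
move=> [lA [a Aa]] [lB [b Bb]]; split; last by exists (a + b); exact: op_norm_leD.
by move=> c x y; rewrite !fctE lA lB scalerDr addrACA.
Qed.

Lemma boundedM A B : bounded_op A -> bounded_op B -> bounded_op (A \o B).
Proof.
move=> bA [lB [b Bb]]; have [a a0 Aa] := bounded_opP bA.
split; last by exists (a * b); apply: op_norm_leM => //; exact: ltW.
by move=> c x y /=; rewrite lB bA.1.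
Qed.

Lemma boundedZ (a : R) A : bounded_op A -> bounded_op (a%:C *: A).
Proof.
move=> [lA [c Ac]]; split.
  by move=> b x y; rewrite !fctE lA scalerDr !scalerA mulrC.
exists (`|a| * c) => x; rewrite !fctE normrZ rmorphM -mulrA ler_pM//.
by rewrite normc_def /= expr0n addr0 sqrtr_sqr.
Qed.

(** Symmetry of the real form suffices: with ['i *: y] for [y] it yields that of the imaginary
    part. *)
Definition self_adjoint A := bounded_op A /\
  forall x y, rdot (A x) y = rdot x (A y).

Lemma self_adjoint_id : self_adjoint id.
Proof. by split=> //; exact: bounded_id. Qed.

Lemma self_adjointD A B : self_adjoint A -> self_adjoint B ->
  self_adjoint (A + B).
Proof.
move=> [bA sA] [bB sB]; split; first exact: boundedD.
by move=> x y; rewrite !fctE rdotDl rdotDr sA sB.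
Qed.

Lemma self_adjointZ (a : R) A : self_adjoint A -> self_adjoint (a%:C *: A).
Proof.
move=> [bA sA]; split; first exact: boundedZ.
by move=> x y; rewrite !fctE rdotZl rdotZr sA.
Qed.

Lemma self_adjointB A B : self_adjoint A -> self_adjoint B ->
  self_adjoint (A - B).
Proof.
move=> sA sB; apply: self_adjointD => //.
by rewrite -scaleN1r -(rmorphN1 (real_complex R)); exact: self_adjointZ.
Qed.

Lemma self_adjoint_conj A T : self_adjoint A -> self_adjoint T ->
  self_adjoint (T \o A \o T).
Proof.
move=> [bA sA] [bT sT]; split; first by do 2 apply: boundedM => //.
by move=> x y /=; rewrite sT sA sT.
Qed.

Lemma rdot_ii x y : rdot ('i *: x) ('i *: y) = rdot x y.
Proof.
rewrite rdot_il Im_dotC opprK -[LHS]opprK -rdot_il scalerA.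
by rewrite -expr2 sqr_i scaleN1r rdotNl opprK rdotC.
Qed.

(** Polarization: the form is real, so [rdot (A z) ('i *: z)] vanishes for all [z]; at
    [z = x - 'i *: y] this expands to the required symmetry. *)
Lemma psd_self_adjoint A : bounded_op A -> psd dot A -> self_adjoint A.
Proof.
move=> bA pA; split=> // x y.
have r0 z : rdot (A z) ('i *: z) = 0.
  by rewrite rdot_ir; apply: ger0_Im; exact: pA.
have := r0 (x - 'i *: y).
rewrite (linD bA.1) (linN bA.1) (linZ bA.1) scalerBr scalerA -expr2 sqr_i.
rewrite scaleN1r opprK !rdotE rdot_ii !r0 (rdotC (A y) x) add0r.
have -> : rdot ('i *: A y) y = - rdot (A y) ('i *: y).
  by rewrite rdot_il rdot_ir.
by rewrite ?r0; lra.
Qed.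

Lemma self_adjoint_ir A x : self_adjoint A -> rdot (A x) ('i *: x) = 0.
Proof.
move=> [bA sA]; have : rdot (A x) ('i *: x) = - rdot (A x) ('i *: x).
  by rewrite {1}sA (linZ bA.1) !rdot_ir Im_dotC.
by move/eqP; rewrite -addr_eq0 -mulr2n mulrn_eq0 => /eqP.
Qed.

Lemma psdP A : self_adjoint A ->
  psd dot A <-> forall x, 0 <= rdot (A x) x.
Proof.
move=> sA; split=> pA x; first by have := pA x; rewrite lecE => /andP[].
by rewrite lecE -rdot_ir self_adjoint_ir// eqxx; exact: pA.
Qed.

Lemma loewner_leP A B : self_adjoint A -> self_adjoint B ->
  loewner_le dot A B <-> forall x, rdot (A x) x <= rdot (B x) x.
Proof.
move=> sA sB; rewrite /loewner_le psdP; last exact: self_adjointB.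
by split=> AB x; have := AB x; rewrite !fctE rdotDl rdotNl subr_ge0.
Qed.

(** * Polynomials in an operator, with complex and with real coefficients *)

Implicit Types (a : R[i]) (q r : {poly R[i]}).

(** Complex coefficients allow the splitting of a polynomial into linear factors. *)
Definition cpoly_op (q : {poly R[i]}) A x : H :=
  \sum_(i < size q) q`_i *: iter i A x.

Lemma cpoly_op_wide n q A x : (size q <= n)%N ->
  cpoly_op q A x = \sum_(i < n) q`_i *: iter i A x.
Proof.
move=> qn; rewrite /cpoly_op (big_ord_widen _ (fun i => q`_i *: iter i A x) qn).
rewrite big_mkcond; apply: eq_bigr => i _; case: ltnP => // qi.
by rewrite nth_default// scale0r.
Qed.

Lemma cpoly_opD q r A x : cpoly_op (q + r) A x = cpoly_op q A x + cpoly_op r A x.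
Proof.
pose n := maxn (size q) (size r).
rewrite (@cpoly_op_wide n) ?size_polyD// (@cpoly_op_wide n) ?leq_maxl//.
rewrite (@cpoly_op_wide n r) ?leq_maxr// -big_split; apply: eq_bigr => i _.
by rewrite coefD scalerDl.
Qed.

Lemma cpoly_opZ a q A x : cpoly_op (a *: q) A x = a *: cpoly_op q A x.
Proof.
rewrite (@cpoly_op_wide (size q)) ?size_scale_leq// scaler_sumr.
by apply: eq_bigr => i _; rewrite coefZ scalerA.
Qed.

Lemma cpoly_opC a A x : cpoly_op a%:P A x = a *: x.
Proof.
by rewrite (@cpoly_op_wide 1) ?size_polyC_leq1// big_ord1 coefC eqxx.
Qed.

Lemma cpoly_opMX q A x : linear A -> cpoly_op (q * 'X) A x = A (cpoly_op q A x).
Proof.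
move=> lA; rewrite (@cpoly_op_wide (size q).+1); last first.
  by rewrite (leq_trans (size_polyMleq _ _))// size_polyX addn2.
rewrite big_ord_recl coefMX eqxx scale0r add0r (lin_sum lA).
by apply: eq_bigr => i _; rewrite coefMX (linZ lA) iterS.
Qed.

Lemma cpoly_opM q r A x : linear A ->
  cpoly_op (q * r) A x = cpoly_op q A (cpoly_op r A x).
Proof.
move=> lA; elim/poly_ind: q => [|q c IH].
  by rewrite mul0r -polyC0 !cpoly_opC !scale0r.
rewrite mulrDl -mulrA (mulrC 'X) mulrA mul_polyC !cpoly_opD cpoly_opZ.
by rewrite !cpoly_opMX// IH cpoly_opC.
Qed.

Lemma poly_opE (q : {poly R}) A : poly_op q A = cpoly_op (map_poly (real_complex R) q) A.
Proof.
apply/funext => x; rewrite /poly_op fct_sumE /cpoly_op size_map_poly.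
by apply: eq_bigr => i _; rewrite coef_map.
Qed.

Lemma poly_opD (q r : {poly R}) A : poly_op (q + r) A = poly_op q A + poly_op r A.
Proof.
by rewrite !poly_opE; apply/funext => x; rewrite rmorphD cpoly_opD.
Qed.

Lemma poly_opZ (a : R) (q : {poly R}) A : poly_op (a *: q) A = a%:C *: poly_op q A.
Proof.
by rewrite !poly_opE; apply/funext => x; rewrite map_polyZ cpoly_opZ.
Qed.

Lemma poly_opN (q : {poly R}) A : poly_op (- q) A = - poly_op q A.
Proof. by rewrite -scaleN1r poly_opZ rmorphN1 scaleN1r. Qed.

Lemma poly_opC (a : R) A : poly_op a%:P A = a%:C *: id.
Proof. by rewrite poly_opE; apply/funext => x; rewrite map_polyC cpoly_opC. Qed.

Lemma poly_opM (q r : {poly R}) A : linear A -> poly_op (q * r) A = poly_op q A \o poly_op r A.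
Proof.
by move=> lA; rewrite !poly_opE; apply/funext => x; rewrite rmorphM cpoly_opM.
Qed.

Lemma poly_opX A : linear A -> poly_op 'X A = A.
Proof.
move=> lA; rewrite poly_opE map_polyX; apply/funext => x.
by rewrite -['X]mul1r cpoly_opMX// -polyC1 cpoly_opC scale1r.
Qed.

Lemma poly_op_self_adjoint (q : {poly R}) A : self_adjoint A -> self_adjoint (poly_op q A).
Proof.
move=> sA; have lA := sA.1.1; elim/poly_ind: q => [|q c IH].
  by rewrite -polyC0 poly_opC; exact: self_adjointZ self_adjoint_id.
rewrite poly_opD poly_opC; apply: self_adjointD; last first.
  exact: self_adjointZ self_adjoint_id.
split; first by rewrite poly_opM// poly_opX//; exact: boundedM IH.1 sA.1.
(* Passing to the adjoint reverses the order of the factors; commuting [q * 'X] on one side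
   compensates. *)
by move=> x y; rewrite {1}mulrC !poly_opM// poly_opX//= sA.2 IH.2.
Qed.

(** * Operators bounded below *)

Definition bounded_below T :=
  exists2 d : R, 0 < d & forall x, d * sqn x <= sqn (T x).

(** Unlike positivity of the form, a lower bound in norm passes to products, so linear factors can
    be treated one by one. *)
Lemma bounded_below_comp A B :
  bounded_below A -> bounded_below B -> bounded_below (A \o B).
Proof.
move=> [a a0 aA] [b b0 bB]; exists (a * b); first exact: mulr_gt0.
by move=> x /=; rewrite (le_trans _ (aA _))// -mulrA ler_pM2l.
Qed.

(** Expand [|T x - d x|^2 >= 0]: then [|T x|^2] is at least [2 d rdot (T x) x - d^2 |x|^2]. *)
Lemma form_bounded_below T (d : R) : 0 < d ->
  (forall x, d * sqn x <= rdot (T x) x) -> bounded_below T.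
Proof.
move=> d0 dT; exists (d ^+ 2); first exact: exprn_gt0.
move=> x; have := sqn_ge0 (T x - d%:C *: x); have := dT x.
by rewrite /sqn !rdotE (rdotC x (T x)); nra.
Qed.

(** For a real [z] below [m] or above [M], [A - z] or [z - A] has a positive form. For [z = a + b i]
    with [b] nonzero, [|(A - z) x|^2 = |(A - a) x|^2 + b^2 |x|^2]. *)
Lemma shift_bounded_below A (m M : R) (z : R[i]) : self_adjoint A ->
  (forall x, m * sqn x <= rdot (A x) x) ->
  (forall x, rdot (A x) x <= M * sqn x) ->
  (forall t : R, m <= t <= M -> z <> t%:C) ->
  bounded_below (fun x => A x - z *: x).
Proof.
move=> sA mA MA zn; case: z zn => a b zn; have [b0|b0] := eqVneq b 0.
  have zE x : (a +i* b) *: x = a%:C *: x by rewrite b0.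
  have [am|ma] := ltP a m.
    apply: (@form_bounded_below _ (m - a)); first by rewrite subr_gt0.
    by move=> x; rewrite zE !rdotE mulrBl lerB// mA.
  have [aM|Ma] := leP a M.
    by have := zn a; rewrite ma aM b0 => /(_ isT); case.
  have [||d d0 dA] := @form_bounded_below (fun x => - (A x - a%:C *: x)) (a - M).
  - by rewrite subr_gt0.
  - by move=> x; have := MA x; rewrite /sqn !rdotE; lra.
  - by exists d => // x; have := dA x; rewrite zE sqnN.
exists (b ^+ 2); first by rewrite exprn_even_gt0.
move=> x; pose T := A - a%:C *: id.
have sT : self_adjoint T.
  by apply: self_adjointB => //; exact: self_adjointZ self_adjoint_id.
have -> : A x - (a +i* b) *: x = T x - b%:C *: ('i *: x).
  rewrite /T !fctE -addrA; congr (_ + _); rewrite -opprD scalerA -scalerDl.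
  by congr (- (_ *: _)); rewrite [LHS]complexE (mulrC b%:C).
(* The cross term is a multiple of [rdot (T x) ('i *: x)], which vanishes for self-adjoint [T]. *)
clearbody T; have := sqn_ge0 (T x); rewrite /sqn !rdotE rdot_ii (rdotC _ (T x)).
by rewrite self_adjoint_ir// -/(sqn x) => T0; rewrite expr2; lra.
Qed.

Lemma prod_bounded_below A (rs : seq R[i]) : linear A ->
  (forall z, z \in rs -> bounded_below (fun x => A x - z *: x)) ->
  bounded_below (cpoly_op (\prod_(z <- rs) ('X - z%:P)) A).
Proof.
move=> lA; elim: rs => [_|z rs IH rsA].
  by exists 1 => // x; rewrite big_nil -polyC1 cpoly_opC scale1r mul1r.
have -> : cpoly_op (\prod_(u <- z :: rs) ('X - u%:P)) A =
   (fun x => A x - z *: x) \o cpoly_op (\prod_(u <- rs) ('X - u%:P)) A.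
  apply/funext => x /=; rewrite big_cons cpoly_opM// cpoly_opD -polyCN cpoly_opC.
  by rewrite -['X]mul1r cpoly_opMX// -polyC1 cpoly_opC scale1r scaleNr.
apply: bounded_below_comp; first by apply: rsA; rewrite mem_head.
by apply: IH => u urs; apply: rsA; rewrite in_cons urs orbT.
Qed.

(* Since [T] is positive, [sqn (T x) <= N * rdot (T x) x] for a bound [N]. *)
Lemma pos_bounded_below T : self_adjoint T -> (forall x, 0 <= rdot (T x) x) ->
  bounded_below T -> exists2 d : R, 0 < d & forall x, d * sqn x <= rdot (T x) x.
Proof.
move=> [bT sT] pT [d d0 dT]; have [N N0 /op_norm_le_sqn TN] := bounded_opP bT.
exists (d / N); first exact: divr_gt0.
move=> x; rewrite mulrAC ler_pdivrMr// (le_trans (dT x))//.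
have TTN : rdot (T (T x)) (T x) <= N * sqn (T x).
  have := TN (T x); have := sqn_ge0 (T (T x) - N%:C *: T x).
  rewrite {1}/sqn !rdotE (rdotC (T x) (T (T x))) -/(sqn (T x)) -/(sqn (T (T x))).
  by move: N0; clear; nra.
(* This expands to [N^2 rdot (T x) x - 2 N |T x|^2 + rdot (T (T x)) (T x) >= 0], and [TTN] bounds
   the last term by [N |T x|^2]. *)
have := pT (N%:C *: x - T x).
rewrite (linD bT.1) (linN bT.1) (linZ bT.1) !rdotE (sT (T x) x) -/(sqn (T x)).
by move: N0 TTN; clear; nra.
Qed.

End Hilbert.

(** * Functional calculus *)

Section FunctionalCalculus.
Variables (R : realType) (H : completeNormedModType R[i]).
Variable dot : {dot H for (Num.conj : R[i] -> R[i])}.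
Hypothesis hdot : norm_from_dot dot.
Implicit Types (A B T : H -> H) (x y : H) (m M : R) (q r : {poly R}).

Local Notation rdot := (rdot dot).
Local Notation sqn := (sqn dot).
Local Notation self_adjoint := (self_adjoint dot).

Lemma sqnZ (c : R[i]) x :
  sqn (c *: x) = (complex.Re c ^+ 2 + complex.Im c ^+ 2) * sqn x.
Proof.
apply: complexI; rewrite rmorphM/= add_Re2_Im2 -!(normE hdot).
by rewrite normrZ exprMn.
Qed.

Lemma sqn_gt0 x : x != 0 -> 0 < sqn x.
Proof.
by move=> x0; rewrite lt_def sqn_ge0// andbT; apply: contra_neq x0; exact: sqn_eq0.
Qed.

(** A Cauchy-Schwarz bound free of square roots, from [|T x - e y|^2 >= 0] and
    [|T x + e y|^2 >= 0]. *)
Lemma op_norm_le_form T (e : R) : 0 < e -> op_norm_le T e ->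
  forall x y, `|rdot (T x) y| *+ 2 <= e * (sqn x + sqn y).
Proof.
move=> e0 /(op_norm_le_sqn hdot) Te x y; have := Te x.
have := sqn_ge0 hdot (T x - e%:C *: y); have := sqn_ge0 hdot (T x + e%:C *: y).
rewrite /sqn !rdotE (rdotC dot y (T x)) -mulr_natr -(ger0_norm (ler0n R 2)) -normrM.
move=> h1 h2 h3; rewrite ler_norml; apply/andP.
by split; rewrite -(ler_pM2l e0); lra.
Qed.

Definition form_between m M A :=
  forall x, m * sqn x <= rdot (A x) x <= M * sqn x.

Section Calculus.
Variables (A : H -> H) (m M : R).
Hypotheses (sA : self_adjoint A) (mAM : form_between m M A).

(** No complex root of [q] lies in the interval, so [shift_bounded_below] covers every linear
    factor. Positivity at [m] makes the leading coefficient nonzero. *)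
Lemma bounded_below_poly_op q : m <= M ->
  (forall t, m <= t <= M -> 0 < q.[t]) -> bounded_below dot (poly_op q A).
Proof.
move=> mM q0; rewrite poly_opE; set r := map_poly _ q.
have rE (t : R) : r.[t%:C] = q.[t]%:C by rewrite horner_map.
have [rs rsE] := closed_field_poly_normal r.
have r0 : lead_coef r != 0.
  rewrite lead_coef_eq0; apply/eqP => r0; have := q0 m; rewrite lexx mM.
  by move=> /(_ isT); rewrite -ltcR -rE r0 horner0 ltxx.
have [|d d0 dP] := @prod_bounded_below _ _ dot A rs sA.1.1.
  move=> z zrs; apply: (@shift_bounded_below _ _ _ hdot A m M) => //.
  - by move=> x; case/andP: (mAM x).
  - by move=> x; case/andP: (mAM x).
  - move=> t mtM zt; have := q0 t mtM; rewrite -ltcR -rE -zt rsE hornerZ.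
    rewrite horner_prod (big_rem z zrs) /= hornerXsubC subrr mul0r mulr0.
    by rewrite ltxx.
pose c := complex.Re (lead_coef r) ^+ 2 + complex.Im (lead_coef r) ^+ 2.
have c0 : 0 < c.
  by rewrite -ltcR add_Re2_Im2 exprn_gt0// normr_gt0.
exists (c * d); first exact: mulr_gt0.
by move=> x; rewrite {1}rsE cpoly_opZ sqnZ -mulrA ler_pM2l.
Qed.

Lemma poly_op_ge0 q : (forall t, m <= t <= M -> 0 <= q.[t]) ->
  forall x, 0 <= rdot (poly_op q A x) x.
Proof.
move=> q0 x; have [->|xn0] := eqVneq x 0.
  by rewrite rdotC rdot0l.
(* A nonzero vector is what orders [m] and [M]: on the zero space every pair satisfies the form
   bounds. *)
have mM : m <= M.
  by have /andP[/le_trans h /h] := mAM x; rewrite ler_pM2r// sqn_gt0.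
move: x {xn0}; pose T := poly_op q A.
have sT : self_adjoint T by exact: poly_op_self_adjoint.
have [N N0 TN] := bounded_opP sT.1.
pose S := [set s : R | 0 <= s /\ forall x, 0 <= rdot (T x) x + s * sqn x].
have SN : S N.
  split=> [|x]; first exact: ltW.
  have := op_norm_le_form N0 TN x x; have := ler_norm (- rdot (T x) x).
  by rewrite normrN; lra.
have lS : lbound S 0 by move=> s [].
have iS : has_inf S by split; [exists N|exists 0].
pose s := inf S.
have s0 : 0 <= s by apply: lb_le_inf => //; exists N.
(* The infimum is attained: for nonzero [x] all members of [S] are at least
   [- rdot (T x) x / sqn x], hence so is [s]. *)
have Ts x : 0 <= rdot (T x) x + s * sqn x.
  have [->|xn0] := eqVneq x 0; first by rewrite /sqn rdotC !rdot0l mulr0 addr0.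
  have x0 := sqn_gt0 xn0; rewrite -lerBlDl sub0r -ler_pdivrMr//.
  apply: lb_le_inf; first by exists N.
  by move=> u [_ /(_ x)]; rewrite ler_pdivrMr// -lerBlDl sub0r.
have [sp|] := ltP 0 s; last first.
  by move=> s0' x; have := Ts x; rewrite (@le_anti _ _ s 0) ?s0 ?s0'// mul0r addr0.
have TE x : poly_op (q + s%:P) A x = T x + s%:C *: x.
  by rewrite poly_opD poly_opC.
have [|||d d0 dT] := @pos_bounded_below _ _ dot hdot (poly_op (q + s%:P) A).
- exact: poly_op_self_adjoint.
- by move=> x; rewrite TE rdotDl rdotZl; exact: Ts.
- by apply: bounded_below_poly_op => // t mt; rewrite hornerD hornerC ltr_wpDl// q0.
(* The margin [d] lets [s] be lowered; the maximum with 0 stays among the nonnegative numbers that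
   [S] admits. *)
have Sd : S (Num.max 0 (s - d)).
  split=> [|x]; first by rewrite le_max lexx.
  have := dT x; rewrite TE rdotDl rdotZl.
  have : (s - d) * sqn x <= Num.max 0 (s - d) * sqn x.
    by rewrite ler_wpM2r ?sqn_ge0// le_max lexx orbT.
  by rewrite -/(sqn x); lra.
have := ge_inf iS.2 Sd; rewrite -/s le_max; case/orP; lra.
Qed.

(** [e^2 - q^2] is nonnegative on the interval, and its form at [x] is [e^2 |x|^2 - |q(A) x|^2]. *)
Lemma poly_op_norm q (e : R) : 0 <= e ->
  (forall t, m <= t <= M -> `|q.[t]| <= e) -> op_norm_le (poly_op q A) e.
Proof.
move=> e0 qe; apply: (sqn_op_norm_le hdot) => // x.
have -> : e ^+ 2 * sqn x =
    rdot (poly_op ((e ^+ 2)%:P - q * q) A x) x + sqn (poly_op q A x).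
  rewrite poly_opD poly_opN poly_opC poly_opM; last exact: sA.1.1.
  rewrite !fctE /= rdotDl rdotNl rdotZl.
  by rewrite (poly_op_self_adjoint q sA).2 -/(sqn _) -/(sqn _) subrK.
rewrite lerDr; apply: poly_op_ge0 => t mt.
rewrite hornerD hornerN hornerC hornerM subr_ge0 -expr2 -real_normK ?num_real//.
by rewrite lerXn2r ?nnegrE// qe.
Qed.

(** The approximation clause of [is_fun_calc] on a fixed interval, where results for several
    functions can be combined. *)
Definition fun_calc_on (f : R -> R) B := forall e : R, 0 < e ->
  exists q, (forall t, m <= t <= M -> `|f t - q.[t]| <= e) /\
            op_norm_le (B - poly_op q A) e.

Implicit Types f g : R -> R.

Lemma fun_calc_on_ext f g B : (forall t, m <= t <= M -> f t = g t) ->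
  fun_calc_on f B -> fun_calc_on g B.
Proof.
move=> fg fB e e0; have [q [fq Bq]] := fB e e0; exists q; split=> // t mt.
by rewrite -fg// fq.
Qed.

Lemma fun_calc_on_poly q : fun_calc_on (horner q) (poly_op q A).
Proof.
move=> e e0; exists q; split=> [t _|x]; first by rewrite subrr normr0 ltW.
by rewrite subrr normr0 mulr_ge0// ler0c ltW.
Qed.

Lemma fun_calc_onD f g B C : fun_calc_on f B -> fun_calc_on g C ->
  fun_calc_on (fun t => f t + g t) (B + C).
Proof.
move=> fB gC e e0; have e2 : 0 < e / 2 by rewrite divr_gt0.
have [q [fq Bq]] := fB _ e2; have [r [gr Cr]] := gC _ e2.
exists (q + r); split=> [t mt|].
  rewrite hornerD opprD addrACA (splitr e) (le_trans (ler_normD _ _))// lerD//.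
    exact: fq.
  exact: gr.
by rewrite poly_opD opprD addrACA (splitr e); exact: op_norm_leD.
Qed.

Lemma fun_calc_onM f g B C : poly_approx m M f -> bounded_op B ->
  fun_calc_on f B -> fun_calc_on g C ->
  fun_calc_on (fun t => f t * g t) (B \o C).
Proof.
move=> /poly_approx_bounded[b1 b10 fb1] bB fB gC e e0.
have [b2 b20 Bb2] := bounded_opP bB.
(* [b] bounds both [f] and the operator [B], and [c] below both [r] and [r(A)], so that one choice
   of [q] and [r] serves functions and operators. *)
pose b := b1 + b2; have b0 : 0 < b by rewrite addr_gt0.
have [r [gr Cr]] := gC (e / (2 * b)) (divr_gt0 e0 (mulr_gt0 (ltr0Sn R 1) b0)).
have [c1 c10 rc1] := horner_bounded r m M.
have [c2 c20 rc2] := bounded_opP (poly_op_self_adjoint r sA).1.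
pose c := c1 + c2; have c0 : 0 < c by rewrite addr_gt0.
have [q [fq Bq]] := fB (e / (2 * c)) (divr_gt0 e0 (mulr_gt0 (ltr0Sn R 1) c0)).
have eE : e = b * (e / (2 * b)) + (e / (2 * c)) * c.
  by field; rewrite !gt_eqF.
exists (q * r); split=> [t mt|].
  have -> : f t * g t - (q * r).[t] =
            f t * (g t - r.[t]) + (f t - q.[t]) * r.[t] by rewrite hornerM; ring.
  rewrite (le_trans (ler_normD _ _))// !normrM [leRHS]eE.
  rewrite lerD// ler_pM// ?gr ?fq//.
    by rewrite (le_trans (fb1 _ mt))// lerDl ltW.
  by rewrite (le_trans (rc1 _ mt))// lerDl ltW.
have -> : B \o C - poly_op (q * r) A =
          (B \o (C - poly_op r A)) + ((B - poly_op q A) \o poly_op r A).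
  rewrite poly_opM; last exact: sA.1.1.
  apply/funext => x; change (B (C x) - poly_op q A (poly_op r A x) =
    B (C x - poly_op r A x) + (B (poly_op r A x) - poly_op q A (poly_op r A x))).
  by rewrite (linD bB.1) (linN bB.1) addrA subrK.
rewrite eE; apply: op_norm_leD; apply: op_norm_leM => //.
- exact: ltW.
- move=> x; rewrite (le_trans (Bb2 x))// ler_wpM2r// lecR lerDr ltW//.
- by rewrite divr_ge0 ?mulr_ge0// ltW.
- move=> x; rewrite (le_trans (rc2 x))// ler_wpM2r// lecR lerDr ltW//.
Qed.

(** Two approximants of [f] are close to each other on the interval, hence so are their values at
    [A] by [poly_op_norm]. *)
Lemma fun_calc_on_unique f B C : fun_calc_on f B -> fun_calc_on f C -> B = C.
Proof.
move=> fB fC.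
have BC (e : R) : 0 < e -> op_norm_le (B - C) e.
  move=> e0; have e4 : 0 < e / 4 by rewrite divr_gt0.
  have [q [fq Bq]] := fB _ e4; have [r [fr Cr]] := fC _ e4.
  have -> : B - C = (B - poly_op q A) + (poly_op (q - r) A - (C - poly_op r A)).
    by rewrite poly_opD poly_opN opprB !subrKA.
  have -> : e = e / 4 + (e / 2 + e / 4) by lra.
  apply: op_norm_leD => //; apply: op_norm_leB => //.
  apply: poly_op_norm => [|t mt]; first by rewrite divr_ge0// ltW.
  have := fq t mt; have := fr t mt.
  by rewrite hornerD hornerN !ler_norml; lra.
apply/funext => x; apply/eqP; rewrite -subr_eq0; apply/negPn/negP => /sqn_gt0 a0.
(* For [e = sqn (B x - C x) / s] the form estimate at [x] and [B x - C x] says that twice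
   [sqn (B x - C x)] is at most itself. *)
pose s := sqn x + sqn (B x - C x).
have s0 : 0 < s by rewrite ltr_wpDl// sqn_ge0.
have e0 := divr_gt0 a0 s0.
have := op_norm_le_form e0 (BC _ e0) x (B x - C x).
rewrite -/(sqn (B x - C x)) -/s divfK ?gt_eqF// ger0_norm; last exact: ltW.
lra.
Qed.

Lemma fun_calc_on_ge0 f B : self_adjoint B -> fun_calc_on f B ->
  (forall t, m <= t <= M -> 0 <= f t) -> forall x, 0 <= rdot (B x) x.
Proof.
move=> sB fB f0 x; rewrite leNgt; apply/negP => Bx.
have [x0|] := eqVneq x 0; first by rewrite x0 rdotC rdot0l ltxx in Bx.
move=> /sqn_gt0 x0.
(* Then [rdot (B x) x = - 4 e sqn x], whereas [q + e] is nonnegative on the interval and the two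
   errors account for [- 2 e sqn x] at most. *)
pose e := - rdot (B x) x / (4 * sqn x).
have e0 : 0 < e by rewrite divr_gt0 ?mulr_gt0// oppr_gt0.
have [q [fq Bq]] := fB _ e0.
have := @poly_op_ge0 (q + e%:P) _ x.
have -> : poly_op (q + e%:P) A x = poly_op q A x + e%:C *: x.
  by rewrite poly_opD poly_opC.
have -> : poly_op q A x = B x - (B - poly_op q A) x by rewrite !fctE opprB addrC subrK.
have := op_norm_le_form e0 Bq x x.
have eE : e * sqn x = - rdot (B x) x / 4 by rewrite /e; field; rewrite gt_eqF.
move: (B - _) => D; rewrite !rdotE -/(sqn x) eE -mulr2n => h1 h2.
have : 0 <= rdot (B x) x - rdot (D x) x + - rdot (B x) x / 4.
  apply: h2 => t mt; rewrite hornerD hornerC.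
  by have := fq t mt; have := f0 t mt; rewrite ler_norml; lra.
move: h1; rewrite mulrnAr lerMn2r/= eE ler_norml; lra.
Qed.

Lemma fun_calc_on_self_adjoint f B : bounded_op B -> fun_calc_on f B ->
  self_adjoint B.
Proof.
move=> bB fB; split=> // x y; apply/eqP; rewrite -subr_eq0 -normr_le0.
apply/ler_addgt0Pr => e e0; rewrite add0r.
pose s := 1 + sqn x + sqn y.
have s0 : 0 < s by rewrite /s -addrA ltr_wpDr// addr_ge0// sqn_ge0.
have [q [_ Bq]] := fB (e / s) (divr_gt0 e0 s0).
have qs := (poly_op_self_adjoint q sA).2 x y.
have -> : rdot (B x) y - rdot x (B y) =
  rdot ((B - poly_op q A) x) y - rdot ((B - poly_op q A) y) x.
  by rewrite !fctE !rdotE qs !(rdotC dot x); lra.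
have := op_norm_le_form (divr_gt0 e0 s0) Bq x y.
have := op_norm_le_form (divr_gt0 e0 s0) Bq y x.
move: (B - _) => D; rewrite (addrC (sqn y)).
have : e / s * (sqn x + sqn y) <= e.
  rewrite mulrAC ler_pdivrMr// ler_pM2l// /s.
  by rewrite -addrA lerDr.
have := ler_normB (rdot (D x) y) (rdot (D y) x); lra.
Qed.

End Calculus.
End FunctionalCalculus.

(** * Existence of the functional calculus *)

Section Existence.
Variables (R : realType) (H : completeNormedModType R[i]).
Variable dot : {dot H for (Num.conj : R[i] -> R[i])}.
Hypothesis hdot : norm_from_dot dot.
Implicit Types (B : H -> H) (x y : H) (f : R -> R).

Local Notation rdot := (rdot dot).
Local Notation sqn := (sqn dot).
Local Notation self_adjoint := (self_adjoint dot).
Local Notation form_between := (form_between dot).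

(** Norms and radii take values in [R[i]]; this returns to real numbers. *)
Lemma real_posE (e : R[i]) : 0 < e -> e = (complex.Re e)%:C /\ 0 < complex.Re e.
Proof. by case: e => a b; rewrite ltcE /= => /andP[/eqP-> a0]. Qed.

Lemma norm_real x : `|x| = (complex.Re `|x|)%:C /\ 0 <= complex.Re `|x|.
Proof.
have : 0 <= `|x| by []; case: `|x| => a b.
by rewrite lecE /= => /andP[/eqP-> a0].
Qed.

(** By [poly_op_norm], polynomials approaching [f] uniformly give a Cauchy sequence at each vector.
    Completeness provides the limit [B x]. *)
Lemma fun_calc_on_exists (A : H -> H) (m M : R) f : self_adjoint A ->
  form_between m M A -> poly_approx m M f ->
  exists B, self_adjoint B /\ fun_calc_on A m M f B.
Proof.
move=> sA mAM fa; pose ep (n : nat) : R := n.+1%:R^-1.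
have ep0 n : 0 < ep n by rewrite invr_gt0.
have /choice[q qP] : forall n : nat, exists q : {poly R},
  forall t, m <= t <= M -> `|f t - q.[t]| <= ep n by move=> n; exact: fa.
have epn n k : (n <= k)%N -> ep k <= ep n.
  by move=> nk; rewrite lef_pV2 ?posrE// ler_nat.
have ep_small (e : R) : 0 < e -> exists n, ep n < e.
  move=> e0; exists (Num.trunc e^-1); rewrite invf_plt ?posrE//.
  exact: truncnS_gt.
pose u x (n : nat) : H := poly_op (q n) A x.
have uu x n k : `|u x n - u x k| <= (ep n + ep k)%:C * `|x|.
  have -> : u x n - u x k = poly_op (q n - q k) A x.
    by rewrite poly_opD poly_opN.
  apply: (poly_op_norm hdot sA mAM) => [|t mt]; first by rewrite addr_ge0// ltW.
  have := qP n t mt; have := qP k t mt.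
  by rewrite hornerD hornerN !ler_norml; lra.
have cu x : cvg (u x @ \oo).
  apply/cauchy_cvgP; apply: cauchy_exP => e /real_posE[-> e0].
  have [xE nx0] := norm_real x; set nx := complex.Re _ in xE nx0.
  have x0 : 0 < 1 + nx by rewrite ltr_pwDl.
  have [n epe] := ep_small _ (divr_gt0 e0 (mulr_gt0 (ltr0Sn R 1) x0)).
  exists (u x n); exists n => // k /= nk; rewrite -ball_normE /ball_ /=.
  rewrite (le_lt_trans (uu x n k))// xE -rmorphM ltcR.
  rewrite ltr_pdivlMr ?mulr_gt0// in epe.
  have := ler_wpM2r nx0 (epn _ _ nk); have := ep0 n; lra.
pose B x : H := lim (u x @ \oo).
have uB x : u x @ \oo --> B x by exact: cu.
have linu n : linear (u^~ n).
  by have [[]] := poly_op_self_adjoint (dot := dot) (q n) sA.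
have linB : linear B.
  move=> a x y; apply: cvg_lim; first exact: norm_hausdorff.
  have -> : u (a *: x + y) = (fun n => a *: u x n + u y n).
    by apply/funext => n; rewrite linu.
  by apply: cvgD (uB y); apply: cvgZl_tmp; exact: uB.
(* The comparison goes through a later index [maxn n N]: its error [ep] is at most [ep n], whence
   the factor 2, and its distance to the limit is at most [e * 1] for arbitrary [e]. *)
have Bu n : op_norm_le (B - poly_op (q n) A) (ep n *+ 2).
  move=> x; apply/ler_addgt0Pr => e e0.
  have /cvgrPdist_le/(_ e e0)[N _ BN] := uB x.
  have := BN (maxn n N) (leq_maxr _ _) => /= Be.
  rewrite !fctE -/(u x n) -(subrKA (u x (maxn n N))).
  rewrite (le_trans (ler_normD _ _))// [leRHS]addrC lerD//.
  rewrite (le_trans (uu x _ _))// ler_wpM2r// lecR mulr2n lerD// epn//.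
  exact: leq_maxl.
have bB : bounded_op B.
  split=> //; have [c _ qc] := bounded_opP (poly_op_self_adjoint (q 0%N) sA).1.
  exists (ep 0%N *+ 2 + c); rewrite -(subrK (poly_op (q 0%N) A) B).
  exact: op_norm_leD (Bu 0%N) qc.
have fB : fun_calc_on A m M f B.
  move=> e e0; have [n epe] := ep_small _ (divr_gt0 e0 (ltr0Sn R 1)).
  exists (q n); split=> [t mt|x].
    by have := qP n t mt; lra.
  rewrite (le_trans (Bu n x))// ler_wpM2r// lecR; lra.
by exists B; split=> //; exact: fun_calc_on_self_adjoint fB.
Qed.

Lemma form_between_loewner (A : H -> H) (m M : R) : self_adjoint A ->
  form_between m M A <->
  loewner_le dot (m%:C *: id) A /\ loewner_le dot A (M%:C *: id).
Proof.
move=> sA; have sI (c : R) : self_adjoint (c%:C *: id).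
  exact/self_adjointZ/self_adjoint_id.
rewrite !loewner_leP//; split=> [mAM|[mA AM] x].
  by split=> x; have /andP[] := mAM x; rewrite rdotZl.
by have := mA x; have := AM x; rewrite !rdotZl => -> ->.
Qed.

Lemma fun_calc_on_sub (A : H -> H) (m M m' M' : R) f B : m <= m' -> M' <= M ->
  fun_calc_on A m M f B -> fun_calc_on A m' M' f B.
Proof.
move=> mm MM fB e e0; have [q [fq Bq]] := fB e e0; exists q; split=> // t.
by move=> /andP[mt tM]; apply: fq; rewrite (le_trans mm)// (le_trans tM).
Qed.

(** [fun_calc] picks an operator whose interval is unknown. Both calculi restrict to the
    intersection of the two intervals, where the form bounds still hold, and uniqueness applies
    there. *)
Lemma fun_calcP (A : H -> H) (m M : R) f : self_adjoint A ->
  form_between m M A -> poly_approx m M f ->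
  self_adjoint (fun_calc dot f A) /\ fun_calc_on A m M f (fun_calc dot f A).
Proof.
move=> sA mAM fa; have [B [sB fB]] := fun_calc_on_exists sA mAM fa.
suff -> : fun_calc dot f A = B by [].
have : is_fun_calc dot f A (fun_calc dot f A).
  apply: (@xgetPex _ 0 [set B | is_fun_calc dot f A B]).
  exists B, m, M; have [mA AM] := (form_between_loewner m M sA).1 mAM.
  by split.
move: (fun_calc _ _ _) => C [m' [M' [m'A AM' fC]]].
have mAM' := (form_between_loewner m' M' sA).2 (conj m'A AM').
apply: (@fun_calc_on_unique _ _ _ hdot A (Num.max m m') (Num.min M M') sA _ f).
- move=> x; have := mAM x; have := mAM' x => /andP[h1 h2] /andP[h3 h4].
  by rewrite maxEle minEle; case: ifP => _; case: ifP => _; apply/andP; split.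
- by apply: fun_calc_on_sub fC; rewrite ?le_max ?ge_min lexx orbT.
- by apply: fun_calc_on_sub fB; rewrite ?le_max ?ge_min lexx.
Qed.

End Existence.

(** * Scalar inequalities behind the comparison of means *)

Section ScalarInequalities.
Variable R : realType.
Implicit Types p q t : R.

Lemma ln_le_subr1 t : 0 < t -> ln t <= t - 1.
Proof.
by move=> t0; rewrite -{1}(subrKC 1 t) le_ln1Dx// ltrBrDl subrr.
Qed.

Lemma ln_ge_1subV t : 0 < t -> 1 - t^-1 <= ln t.
Proof.
move=> t0; have := @ln_le_subr1 t^-1; rewrite invr_gt0 => /(_ t0).
by rewrite lnV ?posrE//; lra.
Qed.

Lemma powR_ge1Dln p t : 0 < t -> 1 + p * ln t <= t `^ p.
Proof. by move=> t0; rewrite /powR gt_eqF// expR_ge1Dx. Qed.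

(** Add the bounds [1 + a ln t <= t ^ a] for [a = - p] and [a = 1 - p] with weights [1 - p] and [p]:
    the logarithms cancel. Then multiply by [t ^ p]. *)
Lemma powR_le_affine p t : 0 <= p <= 1 -> 0 < t -> t `^ p <= 1 - p + p * t.
Proof.
move=> /andP[p0 p1] t0; have tp0 : 0 < t `^ p by exact: powR_gt0.
have h1 := @powR_ge1Dln (- p) t t0; have h2 := @powR_ge1Dln (1 - p) t t0.
have e1 : t `^ (- p) * t `^ p = 1 by rewrite powRN mulVf// gt_eqF.
have e2 : t `^ (1 - p) * t `^ p = t.
  by rewrite -powRD ?subrK ?powRr1 ?ltW// gt_eqF// implybT.
have h : 1 <= (1 - p) * t `^ (- p) + p * t `^ (1 - p).
  have p1' : 0 <= 1 - p by rewrite subr_ge0.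
  by have := ler_wpM2l p1' h1; have := ler_wpM2l p0 h2; lra.
have := ler_wpM2r (ltW tp0) h; rewrite mulrDl -!mulrA e1 e2; lra.
Qed.

(** Combines [1 - ln t <= t^-1] with [ln t <= (t ^ q - 1) / q]. *)
Lemma inv_ge_powR q t : 0 < q -> 0 < t -> 1 + q^-1 - q^-1 * t `^ q <= t^-1.
Proof.
move=> q0 t0; have qi : 0 <= q^-1 by rewrite invr_ge0 ltW.
have h := ler_wpM2l qi (@powR_ge1Dln q t t0); have := ln_ge_1subV t0.
move: h; rewrite mulrDr mulrA mulVf ?gt_eqF//; lra.
Qed.

End ScalarInequalities.

(** * Inverses and powers of positive operators *)

Section OperatorMeans.
Variables (R : realType) (H : completeNormedModType R[i]).
Variable dot : {dot H for (Num.conj : R[i] -> R[i])}.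
Hypothesis hdot : norm_from_dot dot.
Implicit Types (A B C D S T X Y Z : H -> H) (x y : H) (f g : R -> R) (m M : R).

Local Notation rdot := (rdot dot).
Local Notation sqn := (sqn dot).
Local Notation self_adjoint := (self_adjoint dot).
Local Notation form_between := (form_between dot).

(** A quantitative form of the cone, shown equivalent in [pos_coneP]; the bound [m] keeps the
    calculus away from 0. *)
Definition pos_op A := self_adjoint A /\
  exists2 m, 0 < m & forall x, m * sqn x <= rdot (A x) x.

Lemma form_upper A : self_adjoint A ->
  exists2 M, 0 < M & forall x, rdot (A x) x <= M * sqn x.
Proof.
move=> [bA _]; have [M M0 AM] := bounded_opP bA; exists M => // x.
have := op_norm_le_form hdot M0 AM x x; have := ler_norm (rdot (A x) x).
lra.
Qed.

Lemma pos_op_between A : pos_op A -> exists m M, 0 < m /\ form_between m M A.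
Proof.
move=> [sA [m m0 mA]]; have [M M0 AM] := form_upper sA.
by exists m, M; split=> // x; rewrite mA AM.
Qed.

Lemma pos_op_form_ge0 A : pos_op A -> forall x, 0 <= rdot (A x) x.
Proof.
move=> [_ [m m0 mA]] x; apply: le_trans (mA x).
by rewrite mulr_ge0 ?sqn_ge0// ltW.
Qed.

Lemma fun_calc_on_id A m M : self_adjoint A -> fun_calc_on A m M id A.
Proof.
move=> sA; have := @fun_calc_on_poly _ _ A m M 'X; rewrite (poly_opX sA.1.1).
by apply: fun_calc_on_ext => t _; rewrite hornerX.
Qed.

Lemma fun_calc_on1 A m M : fun_calc_on A m M (fun=> 1) id.
Proof.
have := @fun_calc_on_poly _ _ A m M 1%:P; rewrite poly_opC rmorph1 scale1r.
by apply: fun_calc_on_ext => t _; rewrite hornerC.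
Qed.

Lemma fun_calc_onZ A m M f B (c : R) : self_adjoint A ->
  fun_calc_on A m M f B ->
  fun_calc_on A m M (fun t => c * f t) (c%:C *: B).
Proof.
move=> sA fB; have sI := self_adjointZ c (self_adjoint_id dot).
have := @fun_calc_onM _ _ dot A m M sA (fun=> c) f (c%:C *: id) B.
apply=> //; last 1 first.
- move=> e e0; exists c%:P; split=> [t _|x].
    by rewrite hornerC subrr normr0 ltW.
  by rewrite poly_opC subrr normr0 mulr_ge0// ler0c ltW.
- move=> e e0; exists c%:P => t _.
  by rewrite hornerC subrr normr0 ltW.
- exact: sI.1.
Qed.

(** The passage from scalar to operator inequalities: positivity of the calculus, applied to
    [g - b f - a]. *)
Lemma fun_calc_affine_le A m M f g B D (a b : R) :
  self_adjoint A -> form_between m M A -> self_adjoint B -> self_adjoint D ->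
  fun_calc_on A m M f B -> fun_calc_on A m M g D ->
  (forall t, m <= t <= M -> a + b * f t <= g t) ->
  forall x, a * sqn x + b * rdot (B x) x <= rdot (D x) x.
Proof.
move=> sA mAM sB sD fB gD fg x.
have fc := fun_calc_onD gD (fun_calc_onD
  (fun_calc_onZ (- b) sA fB) (@fun_calc_on_poly _ _ A m M (- a)%:P)).
have sF : self_adjoint (D + ((- b)%:C *: B + poly_op (- a)%:P A)).
  apply: self_adjointD => //; apply: self_adjointD; first exact: self_adjointZ.
  exact: poly_op_self_adjoint.
have := fun_calc_on_ge0 hdot sA mAM sF fc.
rewrite poly_opC => /(_ _ x); rewrite !fctE !rdotE -/(sqn x) => h.
have : 0 <= rdot (D x) x + (- b * rdot (B x) x + - a * sqn x).
  by apply: h => t mt; rewrite hornerC; have := fg t mt; lra.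
lra.
Qed.

Lemma inverse_unique A B C : is_inverse A B -> is_inverse A C -> B = C.
Proof.
move=> [_ _ BA] [_ AC _]; apply/funext => x.
by rewrite -{1}(congr1 (@^~ x) AC) /= -[LHS]/((B \o A) (C x)) BA.
Qed.

Lemma pos_op_inverse A : pos_op A ->
  is_inverse A (fun_calc dot (fun t => t^-1) A).
Proof.
move=> pA; have sA := pA.1; have [m [M [m0 mAM]]] := pos_op_between pA.
have inv_approx := poly_approx_inv M m0.
have [sE fE] := fun_calcP hdot sA mAM inv_approx.
have fA := fun_calc_on_id m M sA.
have id_approx : poly_approx m M (@id R).
  by move=> e e0; exists 'X => t _; rewrite hornerX subrr normr0 ltW.
split; first exact: sE.1.
  apply: (fun_calc_on_unique hdot sA mAM _ (fun_calc_on1 A m M)).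
  apply: fun_calc_on_ext (fun_calc_onM sA id_approx sA.1 fA fE).
  by move=> t /andP[mt _]; rewrite divff// gt_eqF// (lt_le_trans m0).
apply: (fun_calc_on_unique hdot sA mAM _ (fun_calc_on1 A m M)).
apply: fun_calc_on_ext (fun_calc_onM sA inv_approx sE.1 fE fA).
by move=> t /andP[mt _]; rewrite mulVf// gt_eqF// (lt_le_trans m0).
Qed.

Lemma opinvP A : pos_op A -> is_inverse A (opinv A).
Proof.
move=> pA; apply: (@xgetPex _ 0 [set B | is_inverse A B]).
by exists (fun_calc dot (fun t => t^-1) A); exact: pos_op_inverse.
Qed.

Lemma inverse_sqn_ge S T : bounded_op S -> S \o T = id ->
  exists2 c : R, 0 < c & forall x, c * sqn x <= sqn (T x).
Proof.
move=> bS ST; have [c c0 /(op_norm_le_sqn hdot) Sc] := bounded_opP bS.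
exists (c ^+ 2)^-1; first by rewrite invr_gt0 exprn_gt0.
move=> x; rewrite mulrC ler_pdivrMr ?exprn_gt0// mulrC.
by have := Sc (T x); rewrite -[S (T x)]/((S \o T) x) ST.
Qed.

(** An inverse bounds [A] below in norm, and [pos_bounded_below] makes this a bound of the form.
    Conversely the calculus of [t^-1] provides the inverse. *)
Lemma pos_coneP A : pos_cone dot A <-> pos_op A.
Proof.
split=> [[bA pA [B [bB AB BA]]]|pA]; last first.
  split; [exact: pA.1.1|exact: (psdP pA.1).2 (pos_op_form_ge0 pA)|].
  by exists (opinv A); exact: opinvP.
have sA := psd_self_adjoint bA pA; split=> //.
apply: (pos_bounded_below hdot) => //; first exact: (psdP sA).1 pA.
exact: inverse_sqn_ge bB BA.
Qed.

(** The form of [T A T] at [x] is that of [A] at [T x], and the left inverse [S] bounds [T]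
    below. *)
Lemma pos_op_conj A S T : pos_op A -> self_adjoint T -> bounded_op S ->
  S \o T = id -> pos_op (T \o A \o T).
Proof.
move=> [sA [m m0 mA]] sT bS ST; split; first exact: self_adjoint_conj.
have [c c0 cT] := inverse_sqn_ge bS ST; exists (m * c); first exact: mulr_gt0.
by move=> x /=; rewrite sT.2 -mulrA (le_trans _ (mA _))// ler_pM2l.
Qed.

Lemma inverse_pos_op A B : pos_op A -> is_inverse A B -> pos_op B.
Proof.
move=> [sA [m m0 mA]] [bB AB BA].
have ABE x : A (B x) = x by rewrite -[LHS]/((A \o B) x) AB.
split; first by split=> // x y; rewrite -{1}(ABE y) -sA.2 ABE.
have [c c0 cB] := inverse_sqn_ge sA.1 AB; exists (m * c); first exact: mulr_gt0.
move=> x; rewrite -{3}(ABE x) -sA.2 -mulrA (le_trans _ (mA _))//.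
by rewrite ler_pM2l.
Qed.

Lemma inverse_fun_calc A D m M : 0 < m -> pos_op A -> form_between m M A ->
  is_inverse A D -> self_adjoint D /\ fun_calc_on A m M (fun t => t^-1) D.
Proof.
move=> m0 pA mAM /(inverse_unique (pos_op_inverse pA)) <-.
exact: (fun_calcP hdot pA.1 mAM (poly_approx_inv M m0)).
Qed.

Lemma oppow_self_adjoint A (p : R) : pos_op A -> self_adjoint (oppow dot A p).
Proof.
move=> pA; have [m [M [m0 mAM]]] := pos_op_between pA.
exact: (fun_calcP hdot pA.1 mAM (poly_approx_powR M p m0)).1.
Qed.

Lemma oppowD A (p q : R) : pos_op A ->
  oppow dot A p \o oppow dot A q = oppow dot A (p + q).
Proof.
move=> pA; have sA := pA.1; have [m [M [m0 mAM]]] := pos_op_between pA.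
have fc r := fun_calcP hdot sA mAM (poly_approx_powR M r m0).
apply: (fun_calc_on_unique hdot sA mAM _ (fc (p + q)).2).
apply: fun_calc_on_ext (fun_calc_onM sA (poly_approx_powR M p m0)
  (fc p).1.1 (fc p).2 (fc q).2).
move=> t /andP[mt _]; have t0 := lt_le_trans m0 mt.
by rewrite powRD//; apply/implyP => _; rewrite gt_eqF.
Qed.

Lemma oppow0 A : pos_op A -> oppow dot A 0 = id.
Proof.
move=> pA; have sA := pA.1; have [m [M [m0 mAM]]] := pos_op_between pA.
have [_ fc] := fun_calcP hdot sA mAM (poly_approx_powR M 0 m0).
apply: (fun_calc_on_unique hdot sA mAM fc).
by apply: fun_calc_on_ext (fun_calc_on1 A m M) => t _; rewrite powRr0.
Qed.

Lemma oppow1 A : pos_op A -> oppow dot A 1 = A.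
Proof.
move=> pA; have sA := pA.1; have [m [M [m0 mAM]]] := pos_op_between pA.
have [_ fc] := fun_calcP hdot sA mAM (poly_approx_powR M 1 m0).
apply: (fun_calc_on_unique hdot sA mAM fc).
apply: fun_calc_on_ext (fun_calc_on_id m M sA) => t /andP[mt _]; rewrite powRr1//.
by rewrite (le_trans _ mt)// ltW.
Qed.

Lemma oppow_halves A (r := oppow dot A 2^-1) (s := oppow dot A (- 2^-1)) :
  pos_op A ->
  [/\ self_adjoint r, self_adjoint s, forall x, r (r x) = A x,
      forall x, r (s x) = x & forall x, s (r x) = x].
Proof.
move=> pA; split; [exact: oppow_self_adjoint..| | |] => x.
- rewrite -[LHS]/((r \o r) x) oppowD//.
  by rewrite (_ : 2^-1 + 2^-1 = 1) ?oppow1//; lra.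
- by rewrite -[LHS]/((r \o s) x) oppowD// subrr oppow0.
- by rewrite -[LHS]/((s \o r) x) oppowD// addNr oppow0.
Qed.

Lemma oppow_le_affine A (p : R) : 0 < p <= 1 -> pos_op A -> forall x,
  rdot (oppow dot A p x) x <= (1 - p) * sqn x + p * rdot (A x) x.
Proof.
move=> /andP[p0 p1] pA x; have sA := pA.1.
have [m [M [m0 mAM]]] := pos_op_between pA.
have [sP fc] := fun_calcP hdot sA mAM (poly_approx_powR M p m0).
(* The power has to stand on the smaller side, so the scalar inequality is solved for [t]:
   [(t ^ p - (1 - p)) / p <= t]. *)
have := @fun_calc_affine_le A m M _ _ _ _ (- (1 - p) / p) p^-1 sA mAM sP sA fc
  (fun_calc_on_id m M sA).
have pp : p * p^-1 = 1 by rewrite mulfV// gt_eqF.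
move=> /(_ _ x) h.
have {}h : - (1 - p) / p * sqn x + p^-1 * rdot (oppow dot A p x) x <= rdot (A x) x.
  apply: h => t /andP[mt _]; rewrite mulrC -mulrDr mulrC ler_pdivrMr//.
  have t0 := lt_le_trans m0 mt; have := @powR_le_affine R p t _ t0.
  by rewrite (ltW p0) p1 => /(_ isT); lra.
have := ler_wpM2l (ltW p0) h.
have -> : p * (- (1 - p) / p * sqn x + p^-1 * rdot (oppow dot A p x) x) =
   (p * p^-1) * (- (1 - p) * sqn x + rdot (oppow dot A p x) x) by ring.
by rewrite pp; lra.
Qed.

Lemma inverse_ge_oppow A D (q : R) : 0 < q -> pos_op A -> is_inverse A D ->
  forall x, (1 + q^-1) * sqn x - q^-1 * rdot (oppow dot A q x) x <= rdot (D x) x.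
Proof.
move=> q0 pA AD x; have sA := pA.1; have [m [M [m0 mAM]]] := pos_op_between pA.
have [sP fP] := fun_calcP hdot sA mAM (poly_approx_powR M q m0).
have [sD fD] := inverse_fun_calc m0 pA mAM AD.
rewrite -mulNr; apply: (fun_calc_affine_le sA mAM sP sD fP fD) => t /andP[mt _].
by rewrite mulNr inv_ge_powR// (lt_le_trans m0).
Qed.

Lemma inverse_ge_oplog A D : pos_op A -> is_inverse A D ->
  forall x, sqn x - rdot (oplog dot A x) x <= rdot (D x) x.
Proof.
move=> pA AD x; have sA := pA.1; have [m [M [m0 mAM]]] := pos_op_between pA.
have [sP fP] := fun_calcP hdot sA mAM (poly_approx_ln M m0).
have [sD fD] := inverse_fun_calc m0 pA mAM AD.
rewrite -[sqn x]mul1r -mulN1r.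
apply: (fun_calc_affine_le sA mAM sP sD fP fD) => t /andP[mt _].
by have := ln_ge_1subV (lt_le_trans m0 mt); lra.
Qed.

End OperatorMeans.

(** * Power means and the arithmetic mean *)

Section PowerMeans.
Variables (R : realType) (H : completeNormedModType R[i]).
Variable dot : {dot H for (Num.conj : R[i] -> R[i])}.
Hypothesis hdot : norm_from_dot dot.
Implicit Types (Y Z : H -> H) (x y : H).

Local Notation rdot := (rdot dot).
Local Notation sqn := (sqn dot).
Local Notation self_adjoint := (self_adjoint dot).
Local Notation pos_op := (pos_op dot).

Lemma inverseK (A B : H -> H) : is_inverse A B -> cancel A B /\ cancel B A.
Proof.
by case=> _ AB BA; split=> x;
   [exact: (congr1 (@^~ x) BA) | exact: (congr1 (@^~ x) AB)].
Qed.

Lemma sum_prob_affine k (lam : 'I_k -> R) (c d : R) (f : 'I_k -> R) :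
  prob_vec lam -> \sum_j lam j * (c + d * f j) = c + d * \sum_j lam j * f j.
Proof.
move=> [_ lam1]; under eq_bigr do rewrite mulrDr mulrCA.
by rewrite big_split /= -mulr_suml lam1 mul1r mulr_sumr.
Qed.

Lemma rdot_comb k (c : 'I_k -> R) (F : 'I_k -> H -> H) x y :
  rdot ((\sum_j (c j)%:C *: F j) x) y = \sum_j c j * rdot (F j x) y.
Proof.
rewrite fct_sumE rdot_suml; apply: eq_bigr => j _.
by rewrite !fctE rdotZl.
Qed.

Variables (k : nat) (lam : 'I_k -> R) (X : 'I_k -> H -> H).
Hypotheses (hlam : prob_vec lam) (hX : forall j, pos_op (X j)).

(** Conjugating [C ^ p <= 1 - p + p C], for [C = s X_j s], by [r] bounds the geometric mean of [Y]
    and [X_j] by [(1 - p) Y + p X_j]. The geometric means average to [Y], and [(1 - p) Y]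
    cancels. *)
Lemma pos_power_mean_le_arith (p : R) Y : 0 < p <= 1 ->
  is_pos_power_mean dot p lam X Y ->
  forall x, rdot (Y x) x <= \sum_j lam j * rdot (X j x) x.
Proof.
move=> p01 [/(pos_coneP hdot) pY YE] x.
move: (oppow_halves hdot pY) YE; rewrite /geo_mean.
move: (oppow dot Y 2^-1) (oppow dot Y (- 2^-1)) => r s [sr ss rr rs sr1] YE.
have geo_le j : rdot (r (oppow dot (s \o X j \o s) p (r x))) x <=
    (1 - p) * rdot (Y x) x + p * rdot (X j x) x.
  rewrite sr.2.
  have pC : pos_op (s \o X j \o s).
    by apply: pos_op_conj (hX j) ss sr.1 _ => //; apply/funext.
  apply: le_trans (oppow_le_affine hdot p01 pC (r x)) _.
  by rewrite /= ss.2 !sr1 /sqn -sr.2 rr.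
have : rdot (Y x) x <= \sum_j lam j *
    ((1 - p) * rdot (Y x) x + p * rdot (X j x) x).
  rewrite {1}YE rdot_comb; apply: ler_sum => j _.
  by rewrite ler_pM2l ?geo_le//; exact: hlam.1.
rewrite sum_prob_affine//.
have p0 : 0 < p by case/andP: p01.
by move=> h; rewrite -(ler_pM2l p0); lra.
Qed.

(** Conjugated by [s], the equation of [Z] says that the powers [P j] average to the identity. The
    inverse [r X_j r] of [s X_j^-1 s] is at least [1 + 1/q - P j / q]; these bounds average to 1,
    which at [u = s x] is the claim. *)
Lemma neg_power_mean_le_arith (q : R) Z : 0 < q ->
  is_pos_power_mean dot q lam (fun j => opinv (X j)) Z ->
  forall x, rdot (opinv Z x) x <= \sum_j lam j * rdot (X j x) x.
Proof.
move=> q0 [/(pos_coneP hdot) pZ ZE] x.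
move: (oppow_halves hdot pZ) ZE; rewrite /geo_mean.
move: (oppow dot Z 2^-1) (oppow dot Z (- 2^-1)) => r s [sr ss rr rs sr1] ZE.
pose u := s x.
have uE : rdot (opinv Z x) x = sqn u.
  have xE : Z (s u) = x by rewrite -rr !rs.
  by rewrite -{1}xE (inverseK (opinvP hdot pZ)).1 ss.2.
pose P j := oppow dot (s \o opinv (X j) \o s) q.
have X_le j : (1 + q^-1) * sqn u + - q^-1 * rdot (P j u) u <= rdot (X j x) x.
  have iX := opinvP hdot (hX j); have [XK KX] := inverseK iX.
  have pC : pos_op (s \o opinv (X j) \o s).
    apply: pos_op_conj (inverse_pos_op hdot (hX j) iX) ss sr.1 _ => //.
    by apply/funext.
  have CD : is_inverse (s \o opinv (X j) \o s) (r \o X j \o r).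
    split; first exact: (self_adjoint_conj (hX j).1 sr).1.
      by apply/funext => y /=; rewrite sr1 XK sr1.
    by apply/funext => y /=; rewrite rs KX rs.
  have := inverse_ge_oppow hdot q0 pC CD u.
  by rewrite /= rs sr.2 rs mulNr.
have PE : \sum_j lam j * rdot (P j u) u = sqn u.
  have : rdot (Z (s u)) (s u) = sqn u by rewrite -rr sr.2 rs.
  rewrite {1}ZE rdot_comb => <-; apply: eq_bigr => j _.
  by rewrite /= sr.2 rs.
have : \sum_j lam j * ((1 + q^-1) * sqn u + - q^-1 * rdot (P j u) u) <=
       \sum_j lam j * rdot (X j x) x.
  by apply: ler_sum => j _; rewrite ler_pM2l//; exact: hlam.1.
by rewrite sum_prob_affine// PE uE; lra.
Qed.

(** The inverse [s X_j s] of [r X_j^-1 r] is at least [1 - L j]; the logarithms [L j] average to 0,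
    and [u = r x] turns the rest into the claim. *)
Lemma karcher_mean_le_arith Y : is_karcher_mean dot lam X Y ->
  forall x, rdot (Y x) x <= \sum_j lam j * rdot (X j x) x.
Proof.
move=> [/(pos_coneP hdot) pY YE] x.
move: (oppow_halves hdot pY) YE => /=.
move: (oppow dot Y 2^-1) (oppow dot Y (- 2^-1)) => r s [sr ss rr rs sr1] YE.
pose u := r x; pose L j := oplog dot (r \o opinv (X j) \o r).
have X_le j : sqn u + - 1 * rdot (L j u) u <= rdot (X j x) x.
  have iX := opinvP hdot (hX j); have [XK KX] := inverseK iX.
  have pC : pos_op (r \o opinv (X j) \o r).
    apply: pos_op_conj (inverse_pos_op hdot (hX j) iX) sr ss.1 _ => //.
    by apply/funext.
  have CD : is_inverse (r \o opinv (X j) \o r) (s \o X j \o s).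
    split; first exact: (self_adjoint_conj (hX j).1 ss).1.
      by apply/funext => y /=; rewrite rs XK rs.
    by apply/funext => y /=; rewrite sr1 KX sr1.
  have := inverse_ge_oplog hdot pC CD u.
  by rewrite /= sr1 ss.2 sr1 mulN1r.
have LE : \sum_j lam j * rdot (L j u) u = 0.
  by rewrite -rdot_comb YE -[X in rdot X](_ : 0 = _)// rdot0l.
have : \sum_j lam j * (sqn u + - 1 * rdot (L j u) u) <=
       \sum_j lam j * rdot (X j x) x.
  by apply: ler_sum => j _; rewrite ler_pM2l//; exact: hlam.1.
by rewrite sum_prob_affine// LE mulr0 addr0 /sqn -sr.2 rr.
Qed.

Lemma power_mean_le_arith (p : R) Y : -1 <= p <= 1 ->
  is_power_mean dot p lam X Y ->
  self_adjoint Y /\ forall x, rdot (Y x) x <= \sum_j lam j * rdot (X j x) x.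
Proof.
move=> /andP[pN1 p1]; rewrite /is_power_mean; case: ifP => [p0 hY|_].
  split; first exact: ((pos_coneP hdot _).1 hY.1).1.
  by apply: pos_power_mean_le_arith hY; rewrite p0.
case: ifP => [p0 [Z [hZ ->]]|_ hY].
  have pZ := (pos_coneP hdot _).1 hZ.1; split.
    exact: (inverse_pos_op hdot pZ (opinvP hdot pZ)).1.
  by apply: neg_power_mean_le_arith hZ; rewrite oppr_gt0.
split; first exact: ((pos_coneP hdot _).1 hY.1).1.
exact: karcher_mean_le_arith.
Qed.

End PowerMeans.

(** * Scalar means *)

Section ScalarMeans.
Variable R : realType.
Variables (k : nat) (lam mu : 'I_k -> R).
Hypotheses (hlam : prob_vec lam) (hmu : forall j, 0 < mu j).

Lemma prob_vec_gt0 : (0 < k)%N.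
Proof.
case: k lam hlam => // l [_] /eqP; rewrite big_ord0 eq_sym oner_eq0//.
Qed.

Lemma prob_sum_gt0 (f : 'I_k -> R) : (forall j, 0 < f j) ->
  0 < \sum_j lam j * f j.
Proof.
move=> f0; rewrite (bigD1 (Ordinal prob_vec_gt0))//= ltr_pwDl//.
  by rewrite mulr_gt0//; exact: hlam.1.
by apply: sumr_ge0 => j _; rewrite mulr_ge0 ?ltW//; exact: hlam.1.
Qed.

(** Rescaled by [T], the [mu j] have harmonic mean 1, and their power mean has to be at least 1.
    [Tln] settles [p = 0] and, by [1 + p ln t <= t ^ p], positive [p]. For negative [p],
    [powR_le_affine] at the exponent [- p] shows that the [p]-th powers average to at most 1. *)
Lemma harmonic_le_power_mean (p : R) : -1 <= p ->
  (\sum_j lam j * (mu j)^-1)^-1 <= scalar_power_mean p lam mu.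
Proof.
move=> pN1; set T := \sum_j _; have T0 : 0 < T.
  by apply: prob_sum_gt0 => j; rewrite invr_gt0.
have Tln : 0 <= \sum_j lam j * ln (T * mu j).
  have : \sum_j lam j * (1 + - T^-1 * (mu j)^-1) <= \sum_j lam j * ln (T * mu j).
    apply: ler_sum => j _; rewrite ler_pM2l; last exact: hlam.1.
    by have := ln_ge_1subV (mulr_gt0 T0 (hmu j)); rewrite invfM; lra.
  by rewrite sum_prob_affine// -/T mulNr mulVf ?gt_eqF// subrr.
have lnTmu j : ln (T * mu j) = ln T + ln (mu j) by rewrite lnM ?posrE.
rewrite /scalar_power_mean; case: eqVneq => [_|pn0].
  have -> : \prod_j mu j `^ lam j = expR (\sum_j lam j * ln (mu j)).
    by rewrite expR_sum; apply: eq_bigr => j _; rewrite /powR gt_eqF.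
  rewrite -[T^-1]lnK ?posrE ?invr_gt0// ler_expR lnV ?posrE//.
  move: Tln; under eq_bigr do rewrite lnTmu -[ln (mu _)]mul1r.
  by rewrite sum_prob_affine// mul1r; lra.
set S := \sum_j _; have S0 : 0 < S.
  by apply: prob_sum_gt0 => j; exact: powR_gt0.
have TS : \sum_j lam j * (T * mu j) `^ p = T `^ p * S.
  rewrite mulr_sumr; apply: eq_bigr => j _.
  by rewrite powRM ?ltW// mulrCA.
have lnTS : ln (T `^ p * S) = p * ln T + ln S.
  by rewrite lnM ?posrE ?powR_gt0// ln_powR.
have TS0 : 0 < T `^ p * S by rewrite mulr_gt0// powR_gt0.
suff h : 0 <= ln T + p^-1 * ln S.
  rewrite -ler_ln ?posrE ?invr_gt0 ?powR_gt0// ln_powR lnV ?posrE//; lra.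
have -> : ln T + p^-1 * ln S = p^-1 * ln (T `^ p * S) by rewrite lnTS; field.
have [p0|p0] := ltP 0 p.
  rewrite mulr_ge0 ?invr_ge0 ?(ltW p0)// ln_ge0// -TS.
  apply: (@le_trans _ _ (1 + p * \sum_j lam j * ln (T * mu j))).
    by rewrite lerDl mulr_ge0// ltW.
  rewrite -sum_prob_affine//; apply: ler_sum => j _.
  by rewrite ler_pM2l ?powR_ge1Dln ?mulr_gt0//; exact: hlam.1.
rewrite mulr_le0 ?invr_le0// ln_le0// -TS.
(* This is the average of [1 + p - p / (T * mu j)], as [T] is the average of [(mu j)^-1]. *)
have -> : 1 = 1 + p + - p * T^-1 * T by rewrite mulfVK ?gt_eqF//; lra.
rewrite -sum_prob_affine//; apply: ler_sum => j _; rewrite ler_pM2l; last exact: hlam.1.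
have Tmu0 : 0 < T * mu j by rewrite mulr_gt0.
have := @powR_le_affine R (- p) (T * mu j)^-1.
rewrite invr_gt0 Tmu0 oppr_ge0 p0 opprK /= => /(_ _ isT).
have -> : (T * mu j)^-1 `^ (- p) = (T * mu j) `^ p.
  by rewrite -powR_inv1 ?ltW// -powRrM mulN1r opprK.
rewrite invfM mulrA => -> //; lra.
Qed.

(* Summing [(mu j - a) * (b - mu j) >= 0], divided by [mu j], for the extreme
   values [a] and [b] bounds the arithmetic and harmonic means jointly. *)
Lemma arith_le_kantorovich_harmonic :
  0 < kantorovich mu /\
  \sum_j lam j * (mu j / kantorovich mu) <= (\sum_j lam j * (mu j)^-1)^-1.
Proof.
pose a := vmin mu; pose b := vmax mu.
have mub j : mu j <= b by exact: le_bigmax.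
have mua j : a <= mu j by exact: bigmin_le.
have b0 : 0 < b by exact: lt_le_trans (mub (Ordinal prob_vec_gt0)).
(* The iterated minimum starts from [b], so its positivity uses [b0] too. *)
have a0 : 0 < a by apply/bigmin_gtP; split=> // j _; exact: hmu.
have ab0 : 0 < 4 * b * a by rewrite !mulr_gt0.
have K0 : 0 < kantorovich mu by rewrite divr_gt0// exprn_gt0// addr_gt0.
split=> //; set T := \sum_j lam j * (mu j)^-1.
have T0 : 0 < T by apply: prob_sum_gt0 => j; rewrite invr_gt0.
set S := \sum_j lam j * mu j.
have S0 : 0 < S by exact: prob_sum_gt0.
have -> : \sum_j lam j * (mu j / kantorovich mu) = S / kantorovich mu.
  by rewrite mulr_suml; apply: eq_bigr => j _; rewrite mulrA.
have SabT : S <= a + b + - (a * b) * T.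
  rewrite -sum_prob_affine//; apply: ler_sum => j _.
  rewrite ler_pM2l; last exact: hlam.1.
  rewrite -subr_ge0.
  have -> : a + b + - (a * b) * (mu j)^-1 - mu j = (mu j - a) * (b - mu j) / mu j.
    by field; rewrite gt_eqF.
  by rewrite divr_ge0 ?mulr_ge0 ?subr_ge0// ltW.
rewrite -[T^-1]mul1r ler_pdivlMr// mulrAC ler_pdivrMr// mul1r /kantorovich -/a -/b.
rewrite ler_pdivlMr//.
(* With [(S - a b T)^2 >= 0] this gives [4 S (a b T) <= (S + a b T)^2 <= (a + b)^2]. *)
have : (S + a * b * T) ^+ 2 <= (b + a) ^+ 2.
  have abT0 : 0 < a * b * T by rewrite !mulr_gt0.
  by rewrite lerXn2r ?nnegrE; lra.
have := sqr_ge0 (S - a * b * T); rewrite !expr2; lra.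
Qed.

End ScalarMeans.

(** * Parameterized ordered means *)

Section ParameterizedMean.
Variables (R : realType) (H : completeNormedModType R[i]).
Variable dot : {dot H for (Num.conj : R[i] -> R[i])}.
Hypothesis hdot : norm_from_dot dot.
Variable G : forall n : nat, ('I_n -> R) -> ('I_n -> H -> H) -> H -> H.
Hypothesis hG : ordered_mean dot G.
Variables (n : nat) (w : 'I_n -> R).
Hypothesis hw : prob_vec w.

Implicit Types (A B : 'I_n -> H -> H) (x : H) (nu : R).

Local Notation rdot := (rdot dot).
Local Notation sqn := (sqn dot).
Local Notation self_adjoint := (self_adjoint dot).
Local Notation pos_op := (pos_op dot).

Lemma pos_opD (S T : H -> H) : pos_op S -> pos_op T -> pos_op (S + T).
Proof.
move=> pS [sT [m m0 mT]]; split; first exact: self_adjointD pS.1 sT.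
exists m => // x; rewrite rdotDl (le_trans (mT x))// lerDr.
exact: pos_op_form_ge0.
Qed.

Lemma pos_opZ (a : R) (T : H -> H) : 0 < a -> pos_op T -> pos_op (a%:C *: T).
Proof.
move=> a0 [sT [m m0 mT]]; split; first exact: self_adjointZ.
exists (a * m); first exact: mulr_gt0.
by move=> x; rewrite rdotZl -mulrA ler_pM2l.
Qed.

Lemma pos_op_scalar nu : 0 < nu -> pos_op (nu%:C *: id).
Proof.
move=> nu0; apply: pos_opZ => //; split; first exact: self_adjoint_id.
by exists 1 => // x; rewrite mul1r.
Qed.

Lemma opinv_scalar nu : 0 < nu -> opinv (nu%:C *: id : H -> H) = nu^-1%:C *: id.
Proof.
move=> nu0; apply: (inverse_unique (opinvP hdot (pos_op_scalar nu0))).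
have nuK (a b : R) : a * b = 1 -> (a%:C *: id : H -> H) \o (b%:C *: id) = id.
  by move=> ab; apply/funext => x; rewrite /= !fctE scalerA -rmorphM ab scale1r.
split; first by apply: boundedZ; exact: bounded_id.
  by apply: nuK; rewrite mulfV// gt_eqF.
by apply: nuK; rewrite mulVf// gt_eqF.
Qed.

Lemma mean_pos A : (forall i, pos_op (A i)) -> pos_op (G w A).
Proof.
by move=> pA; apply/(pos_coneP hdot)/(om_cone hG hw) => i; exact/(pos_coneP hdot).
Qed.

(** Superadditivity: concavity at the midpoint of [2 A] and [2 B], with the factors 2 taken out by
    homogeneity. *)
Lemma mean_form_add A B : (forall i, pos_op (A i)) -> (forall i, pos_op (B i)) ->
  forall x, rdot (G w A x) x + rdot (G w B x) x <=
            rdot (G w (fun i => A i + B i) x) x.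
Proof.
move=> pA pB x.
have p2 T : pos_op T -> pos_op (2%:C *: T) by exact: pos_opZ.
have cone T : pos_op T -> pos_cone dot T by exact: (pos_coneP hdot T).2.
have h2 C : (forall i, pos_op (C i)) ->
    G w (fun i => 2%:C *: C i) = 2%:C *: G w C.
  by move=> pC; apply: (om_homogeneous hG hw) => // i; exact: cone.
have half : 0 <= (2^-1 : R) <= 1 by lra.
have := om_concave hG hw (fun i => cone _ (p2 _ (pA i)))
  (fun i => cone _ (p2 _ (pB i))) half.
have E : (1 - 2^-1)%:C * 2%:C = 1 :> R[i] by rewrite -rmorphM; congr _%:C; lra.
have E' : (2^-1)%:C * 2%:C = 1 :> R[i] by rewrite -rmorphM; congr _%:C; lra.
rewrite !h2// !scalerA E E' !scale1r.
have -> : (fun i => (1 - 2^-1)%:C *: (2%:C *: A i) + (2^-1)%:C *: (2%:C *: B i)) =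
          (fun i => A i + B i).
  by apply/funext => i; rewrite !scalerA E E' !scale1r.
move=> /(loewner_leP (self_adjointD (mean_pos pA).1 (mean_pos pB).1)
   (mean_pos (fun i => pos_opD (pA i) (pB i))).1)/(_ x).
by rewrite rdotDl.
Qed.

(** The family is nonempty because an empty sum, the operator 0, need not lie in the cone. *)
Lemma mean_form_sum k (B : 'I_k.+1 -> 'I_n -> H -> H) :
  (forall j i, pos_op (B j i)) -> forall x,
  \sum_j rdot (G w (B j) x) x <= rdot (G w (fun i => \sum_j B j i) x) x.
Proof.
elim: k B => [|k IH] B pB x.
  rewrite big_ord1; have -> // : (fun i => \sum_j B j i) = B ord0.
  by apply/funext => i; rewrite big_ord1.
rewrite big_ord_recl.
have -> : (fun i => \sum_j B j i) =
          (fun i => B ord0 i + \sum_(j < k.+1) B (lift ord0 j) i).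
  by apply/funext => i; rewrite big_ord_recl.
have pS i : pos_op (\sum_(j < k.+1) B (lift ord0 j) i).
  elim: k B pB {IH} => [|k IH] B pB; first by rewrite big_ord1.
  by rewrite big_ord_recl; apply: pos_opD => //; exact: IH (fun j => B (lift ord0 j)) _.
apply: le_trans (mean_form_add (pB ord0) pS x).
by rewrite lerD2l; exact: IH.
Qed.

(** The harmonic mean of copies of one scalar operator is that operator. *)
Lemma mean_scalar_ge nu : 0 < nu -> forall x,
  nu * sqn x <= rdot (G w (fun=> nu%:C *: id) x) x.
Proof.
move=> nu0 x; have pnu := pos_op_scalar nu0.
have cnu (i : 'I_n) : pos_cone dot (nu%:C *: id) by exact/(pos_coneP hdot).
have [+ _] := om_arith_harm hG hw cnu.
have -> : \sum_i (w i)%:C *: opinv (nu%:C *: id : H -> H) = nu^-1%:C *: id.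
  by rewrite opinv_scalar// -scaler_suml -rmorph_sum hw.2 scale1r.
rewrite opinv_scalar ?invr_gt0// invrK.
move=> /(loewner_leP pnu.1 (mean_pos (fun=> pnu)).1)/(_ x).
by rewrite rdotZl.
Qed.

Variable A : 'I_n -> H -> H.
Hypothesis pA : forall i, pos_op (A i).

Lemma pos_op_shift nu : 0 < nu -> forall i, pos_op (A i + nu%:C *: id).
Proof. by move=> nu0 i; apply: pos_opD => //; exact: pos_op_scalar. Qed.

Lemma param_mean_form nu x :
  rdot (param_mean G nu w A x) x =
  rdot (G w (fun i => A i + nu%:C *: id) x) x - nu * sqn x.
Proof. by rewrite /param_mean !fctE rdotDl rdotNl rdotZl. Qed.

(** Superadditivity gives [G (A + nu) - nu >= G A], so the lower bound [m] of [G A] serves here. *)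
Lemma param_mean_pos nu : 0 < nu -> pos_op (param_mean G nu w A).
Proof.
move=> nu0; have [sG [m m0 mG]] := mean_pos pA; split.
  apply: self_adjointB; first exact: (mean_pos (pos_op_shift nu0)).1.
  exact: (pos_op_scalar nu0).1.
exists m => // x; rewrite param_mean_form lerBrDr.
apply: le_trans (mean_form_add pA (fun=> pos_op_scalar nu0) x).
by rewrite lerD// mean_scalar_ge.
Qed.

(** By superadditivity the extra shift [nu' - nu] adds at least itself to the mean, which offsets
    the larger subtraction. It must be positive to lie in the cone, so equality is set apart. *)
Lemma param_mean_mono nu nu' : 0 < nu -> nu <= nu' -> forall x,
  rdot (param_mean G nu w A x) x <= rdot (param_mean G nu' w A x) x.
Proof.
move=> nu0; rewrite le_eqVlt => /predU1P[->//|nunu'] x.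
have d0 : 0 < nu' - nu by rewrite subr_gt0.
rewrite !param_mean_form.
have -> : (fun i => A i + nu'%:C *: id) =
          (fun i => (A i + nu%:C *: id) + (nu' - nu)%:C *: id).
  by apply/funext => i; rewrite -addrA -scalerDl -rmorphD subrKC.
have := mean_form_add (pos_op_shift nu0) (fun=> pos_op_scalar d0) x.
have := mean_scalar_ge d0 x; lra.
Qed.

(** Superadditivity for the families [lam j (A + nu j)], whose sum is [A] shifted by the average of
    the [nu j]; homogeneity takes out [lam j]. *)
Lemma param_mean_concave k (lam nu : 'I_k -> R) : prob_vec lam ->
  (forall j, 0 < nu j) -> forall x,
  \sum_j lam j * rdot (param_mean G (nu j) w A x) x <=
  rdot (param_mean G (\sum_j lam j * nu j) w A x) x.
Proof.
case: k lam nu => [|k] lam nu hlam nu0 x.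
  by have := prob_vec_gt0 hlam.
have lam0 := hlam.1; rewrite param_mean_form.
have pB j i : pos_op ((lam j)%:C *: (A i + (nu j)%:C *: id)).
  by apply: pos_opZ => //; exact: pos_op_shift.
have := mean_form_sum pB x.
have -> : (fun i => \sum_j (lam j)%:C *: (A i + (nu j)%:C *: id)) =
          (fun i => A i + (\sum_j lam j * nu j)%:C *: id).
  apply/funext => i; under eq_bigr do rewrite scalerDr scalerA -rmorphM.
  by rewrite big_split /= -!scaler_suml -!rmorph_sum hlam.2 scale1r.
have -> : \sum_j rdot (G w (fun i => (lam j)%:C *: (A i + (nu j)%:C *: id)) x) x =
    \sum_j lam j * rdot (param_mean G (nu j) w A x) x + (\sum_j lam j * nu j) * sqn x.
  rewrite mulr_suml -big_split; apply: eq_bigr => j _ /=.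
  rewrite (om_homogeneous hG hw) => [|i|//]; last first.
    by apply/(pos_coneP hdot); exact: pos_op_shift.
  by rewrite rdotZl param_mean_form; ring.
lra.
Qed.

End ParameterizedMean.

Theorem proposition4p5 (R : realType) (H : completeNormedModType R[i])
    (dot : {dot H for (Num.conj : R[i] -> R[i])})
    (hdot : norm_from_dot dot)
    (G : forall n : nat, ('I_n -> R) -> ('I_n -> H -> H) -> H -> H)
    (hG : ordered_mean dot G)
    (n k : nat)
    (A : 'I_n -> H -> H) (hA : forall i, pos_cone dot (A i))
    (w : 'I_n -> R) (hw : prob_vec w)
    (lam : 'I_k -> R) (hlam : prob_vec lam)
    (mu : 'I_k -> R) (hmu : forall j, 0 < mu j)
    (p : R) (hp : -1 <= p < 1)
    (Y : H -> H)
    (hY : is_power_mean dot p lam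
            (fun j => param_mean G (mu j / kantorovich mu) w A) Y) :
  loewner_le dot Y (param_mean G (scalar_power_mean p lam mu) w A).
Proof.
have pA i : pos_op dot (A i) := (pos_coneP hdot (A i)).1 (hA i).
have [K0 SK] := arith_le_kantorovich_harmonic hlam hmu.
have nu0 j : 0 < mu j / kantorovich mu by rewrite divr_gt0.
have S0 := prob_sum_gt0 hlam nu0.
case/andP: hp => pN1 p1.
have SP := le_trans SK (harmonic_le_power_mean hlam hmu pN1).
have pX j := param_mean_pos hdot hG hw pA (nu0 j).
have p11 : -1 <= p <= 1 by rewrite pN1 ltW.
have [sY Yle] := power_mean_le_arith hdot hlam pX p11 hY.
(* [S0] and [SP] make the scalar power mean positive, as [param_mean_pos] requires. *)
have sG := (param_mean_pos hdot hG hw pA (lt_le_trans S0 SP)).1.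
apply/(loewner_leP sY sG) => x; apply: le_trans (Yle x) _.
apply: le_trans (param_mean_concave hdot hG hw pA hlam nu0 x) _.
exact: param_mean_mono.
Qed.
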